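(* Let $V$ be a $\mathbb{Z}^n$-graded vector space and let $Q\in\mathbb{Z}^n$. The mapping $$\psi^V_Q:\mathrm{CoDer}^Q(T(V))\ni Q\mapsto(Q_1,Q_2,\ldots)\in\prod_{p\ge1}M^{(Q,p-1)}(V),$$ which assigns to any weight $Q$ coderivation $Q$ of $(T(V),\Delta)$ its (weight $Q$) corestriction maps $Q_p:V^{\otimes p}\hookrightarrow T(V)\xrightarrow{Q}T(V)\xrightarrow{\mathrm{pr}}V$, where $\mathrm{pr}$ is the canonical projection, is a vector space isomorphism, the inverse of which associates to any sequence $(Q_1,Q_2,\ldots)$ the coderivation $Q$ defined by $$Q(v_1\otimes\ldots\otimes v_p)=\sum_{\substack{I\cup J\cup K=N^{(p)}\\ I,J<K}}\varepsilon_V(I;J)(-1)^{\langle Q,V_I\rangle}\,V_I\otimes Q_{|J|+1}(V_J\otimes v_{k_1})\otimes V_{K\setminus k_1},$$ where $I<K$ means $i_{|I|}<k_1$ and where $v_\ell\in V^{v_\ell}$.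
   Context: Vector spaces are over a field $\mathbb{K}$ of characteristic $0$; for $\alpha,\beta\in\mathbb{Z}^n$, $\langle\alpha,\beta\rangle=\sum_i\alpha_i\beta_i$. A homogeneous vector or graded map and its degree/weight are denoted by the same symbol. $M^{(A,a)}(V)$, $a\ge0$, is the space of $(a+1)$-linear maps $V^{\times(a+1)}\to V$ of weight $A\in\mathbb{Z}^n$ (identified with linear maps on $V^{\otimes(a+1)}$). The tensor product of graded maps is $(f\otimes g)(v_1\otimes v_2)=(-1)^{\langle g,v_1\rangle}f(v_1)\otimes g(v_2)$. $T(V)=\bigoplus_{p\ge1}V^{\otimes p}$ is the reduced tensor space, $\mathbb{Z}^n$-graded by total degree. $N^{(p)}=(1,\ldots,p)$; an unshuffle $I=(i_1<\ldots<i_{|I|})$ is a naturally ordered subset of $N^{(p)}$, possibly empty. In sums, the unshuffles $I,J$ (resp. $I,J,K$) are pairwise disjoint with the indicated union. $V_I=v_{i_1}\otimes\ldots\otimes v_{i_{|I|}}$ (in exponents: its total degree), and $\varepsilon_V(I;J)$ is the Koszul sign of the rearrangement of $(v_{i_1},\ldots,v_{i_{|I|}},v_{j_1},\ldots,v_{j_{|J|}})$ into increasing index order. $I$ and $J$ may be empty, $K=(k_1<k_2<\ldots)$ is nonempty, and the conditions $I<K$, $J<K$ are vacuous for empty $I$, $J$. $\Delta:T(V)\to T(V)\bigotimes T(V)$ is the coproduct $\Delta(v_1\otimes\ldots\otimes v_p)=\sum_{I\cup J=N^{(p-1)},\,I\ne\emptyset}\varepsilon_V(I;J)V_I\bigotimes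 V_J\otimes v_p$. A weight $Q$ coderivation is a linear map $Q:T(V)\to T(V)$ of weight $Q$ with $\Delta Q=(Q\otimes\mathrm{id}+\mathrm{id}\otimes Q)\Delta$; these form the space $\mathrm{CoDer}^Q(T(V))$. *)

(* Defs.v *)
From HB Require Import structures.
From mathcomp Require Import boolp functions.
From mathcomp Require Import all_boot all_order all_algebra.
From mathcomp Require Import finmap zify.
From mathcomp Require monalg.
Import monalg.

Set Implicit Arguments.
Unset Strict Implicit.
Unset Printing Implicit Defensive.

Import Order.TTheory GRing.Theory Num.Theory.
Local Open Scope quotient_scope.
Local Open Scope ring_scope.

Section Span.
Variables (K : fieldType) (M : lmodType K).

Inductive span (R : M -> Prop) : M -> Prop :=
| span_gen x of R x : span R x
| span_zero : span R 0
| span_lin c x y of span R x & span R y : span R (c *: x + y).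

Lemma spanZ R c x : span R x -> span R (c *: x).
Proof. by move=> Rx; rewrite -[_ *: _]addr0; apply: span_lin => //; apply: span_zero. Qed.

Lemma spanD R x y : span R x -> span R y -> span R (x + y).
Proof. by move=> Rx Ry; rewrite -[x]scale1r; apply: span_lin. Qed.

Definition span_pred (R : M -> Prop) : {pred M} := fun x => `[< span R x >].

Fact span_zmod_closed R : zmod_closed (span_pred R).
Proof.
split=> [|x y]; first by apply/asboolP; exact: span_zero.
move=> /asboolP Rx /asboolP Ry; apply/asboolP.
by rewrite addrC -scaleN1r; apply: span_lin.
Qed.
HB.instance Definition _ R :=
  GRing.isZmodClosed.Build M (span_pred R) (span_zmod_closed R).

Lemma span_linear (W : lmodType K) (f g : {linear M -> W}) (R : M -> Prop) x :
  (forall y, R y -> f y = g y) -> span R x -> f x = g x.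
Proof.
move=> fg; elim=> {x} [x /fg//||c x y _ fx _ fy]; first by rewrite !linear0.
by rewrite !linearP fx fy.
Qed.

Variable R : M -> Prop.
Definition qlquot := Quotient.quot (span_pred R).
HB.instance Definition _ := GRing.Zmodule.on qlquot.
HB.instance Definition _ := EqQuotient.on qlquot.

Definition qlpi (x : M) : qlquot := \pi_(Quotient.quot (span_pred R)) x.

Lemma qlpiE x y : qlpi x = qlpi y <-> span R (x - y).
Proof.
rewrite /qlpi; split=> [/eqP|]; last first.
  by move=> s; apply/eqP; rewrite -Quotient.idealrBE; apply/asboolP.
by rewrite -Quotient.idealrBE => /asboolP.
Qed.

Lemma qlpiD x y : qlpi (x + y) = qlpi x + qlpi y. 
Proof. by rewrite /qlpi raddfD. Qed.

Definition qlquot_scale (c : K) (x : qlquot) : qlquot := qlpi (c *: repr x).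

Lemma qlpi_repr (x : qlquot) : qlpi (repr x) = x.
Proof. by rewrite /qlpi reprK. Qed.

Lemma qlpiZ c x : qlpi (c *: x) = qlquot_scale c (qlpi x).
Proof.
apply/qlpiE; rewrite -scalerBr; apply: spanZ; apply/qlpiE.
by rewrite qlpi_repr.
Qed.

Fact qlquot_scaleA a b v : qlquot_scale a (qlquot_scale b v) = qlquot_scale (a * b) v.
Proof. by rewrite -[v]qlpi_repr -!qlpiZ scalerA. Qed.
Fact qlquot_scale1 : left_id 1 qlquot_scale.
Proof. by move=> v; rewrite -[v]qlpi_repr -!qlpiZ scale1r. Qed.
Fact qlquot_scaleDr : right_distributive qlquot_scale +%R.
Proof. by move=> c u v; rewrite -[v]qlpi_repr -[u]qlpi_repr -qlpiD -!qlpiZ -qlpiD scalerDr. Qed.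
Fact qlquot_scaleDl v : {morph qlquot_scale^~ v : a b / a + b}.
Proof. by move=> a b /=; rewrite -[v]qlpi_repr -!qlpiZ -qlpiD scalerDl. Qed.
HB.instance Definition _ := GRing.Zmodule_isLmodule.Build K qlquot
  qlquot_scaleA qlquot_scale1 qlquot_scaleDr qlquot_scaleDl.

Fact qlpi_linear : linear qlpi.
Proof. by move=> c x y; rewrite qlpiD qlpiZ. Qed.
HB.instance Definition _ := GRing.isLinear.Build K M qlquot _ qlpi qlpi_linear.

Fact lquot_exists : {P : lmodType K & {f : {linear M -> P} |
  (forall x, f x = 0 <-> span R x) /\ (forall y, exists x, f x = y)}}.
Proof.
exists (qlquot : lmodType K); exists qlpi; split=> [x|y].
  by rewrite -[x in span _ x]subr0 -qlpiE linear0.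
by exists (repr y); exact: qlpi_repr.
Qed.

(* The quotient of M by the subspace spanned by R; it is opaque, and lpi_eq0
   and lpi_surj characterize it. *)
Definition lquot : lmodType K := projT1 lquot_exists.
Definition lpi : {linear M -> lquot} := sval (projT2 lquot_exists).

Lemma lpi_eq0 x : lpi x = 0 <-> span R x.
Proof. exact: (svalP (projT2 lquot_exists)).1. Qed.

Lemma lpi_surj y : exists x, lpi x = y.
Proof. exact: (svalP (projT2 lquot_exists)).2. Qed.

Lemma lpiE x y : lpi x = lpi y <-> span R (x - y).
Proof.
rewrite -lpi_eq0 linearB; split=> [->|/eqP]; first by rewrite subrr.
by rewrite subr_eq0 => /eqP.
Qed.

Lemma lquot_lift (W : lmodType K) (f : {linear M -> W}) :
  (forall x, R x -> f x = 0) ->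
  exists g : {linear lquot -> W}, forall x, g (lpi x) = f x.
Proof.
move=> f0; have [r rE] := choice lpi_surj.
have E x y : lpi x = lpi y -> f x = f y.
  move=> /lpiE s; apply/eqP; rewrite -subr_eq0 -linearB; apply/eqP.
  by elim: s => {x y} [x /f0//||c x y _ fx _ fy];
    rewrite ?linear0 // linearP fx fy scaler0 addr0.
pose g (x : lquot) := f (r x).
have gE x : g (lpi x) = f x by apply: E; rewrite rE.
have gl : linear g.
  by move=> c x y; rewrite -[x]rE -[y]rE -linearP !gE linearP.
pose mx := GRing.isLinear.Build K lquot W _ g gl.
pose g' : {linear lquot -> W} := HB.pack g mx.
by exists g'.
Qed.

End Span.

Section Presented.
Variables (K : fieldType) (X : choiceType) (W : lmodType K).

Definition malg_ext (F : X -> W) (g : malg X K) : W :=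
  \sum_(x <- msupp g) mcoeff x g *: F x.

Lemma malg_extw F (g : malg X K) (d : {fset X}) : (msupp g `<=` d)%fset ->
  malg_ext F g = \sum_(x <- d) mcoeff x g *: F x.
Proof.
move=> le; rewrite /malg_ext (big_fset_incl _ le) //= => x _ /mcoeff_outdom ->.
by rewrite scale0r.
Qed.

Fact malg_ext_linear F : linear (malg_ext F).
Proof.
move=> c g h; pose d := (msupp g `|` msupp h)%fset.
rewrite !(@malg_extw F _ d) ?fsubsetUl ?fsubsetUr //; last first.
  apply: fsubset_trans (msuppD_le _ _) _; apply: fsetSU; exact: msuppZ_le.
rewrite scaler_sumr -big_split; apply: eq_bigr => x _ /=.
by rewrite mcoeffD mcoeffZ scalerDl scalerA.
Qed.
HB.instance Definition _ F :=
  GRing.isLinear.Build K (malg X K) W _ (malg_ext F) (malg_ext_linear F).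

Lemma malg_extU F x : malg_ext F (mkmalgU x 1) = F x.
Proof.
rewrite (@malg_extw F _ [fset x]%fset) ?msuppU_le // big_seq_fset1.
by rewrite mcoeffUU scale1r.
Qed.
End Presented.

Lemma malg_span (K : fieldType) (X : choiceType) (g : malg X K) :
  span (fun y => exists x, y = mkmalgU x 1) g.
Proof.
rewrite [g]monalgE; elim: (enum_fset _) => [|x s IH].
  by rewrite big_nil; apply: span_zero.
rewrite big_cons; apply: spanD => //.
have -> : mkmalgU x (mcoeff x g) = mcoeff x g *: mkmalgU x 1.
  by apply/malgP => k; rewrite mcoeffZ !mcoeffU mulrnAr mulr1.
by apply: spanZ; apply: span_gen; exists x.
Qed.

Section Pres.
Variables (K : fieldType) (X : choiceType) (R : malg X K -> Prop).

Definition pres : lmodType K := lquot R.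
Definition pgen (x : X) : pres := lpi R (mkmalgU x 1).

Lemma pres_span (z : pres) : span (fun y => exists x, y = pgen x) z.
Proof.
have [y <-] := lpi_surj z; elim: (malg_span y) => {y} [_ [x ->]||c x y _ ? _ ?].
- by apply: span_gen; exists x.
- by rewrite linear0; apply: span_zero.
- by rewrite linearP; apply: span_lin.
Qed.

Lemma pres_lift (W : lmodType K) (F : X -> W) :
  (forall r, R r -> malg_ext F r = 0) ->
  exists f : {linear pres -> W}, forall x, f (pgen x) = F x.
Proof.
by move=> /lquot_lift [f fE]; exists f => x; rewrite fE /= malg_extU.
Qed.
End Pres.

Section Tensor.
Variables (K : fieldType) (U W : lmodType K).
Local Notation gen u w := (mkmalgU (u, w) 1 : malg (U * W)%type K).

Definition tensor_rel : malg (U * W)%type K -> Prop := fun r =>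
  (exists c u u' w, r = gen (c *: u + u') w - (c *: gen u w + gen u' w)) \/
  (exists c u w w', r = gen u (c *: w + w') - (c *: gen u w + gen u w')).

Definition tensor : lmodType K := pres tensor_rel.
Definition tprod (u : U) (w : W) : tensor := pgen tensor_rel (u, w).

Lemma tprodPl c u u' w : tprod (c *: u + u') w = c *: tprod u w + tprod u' w.
Proof.
rewrite /tprod /pgen -linearP; apply/lpiE; apply: span_gen.
by left; exists c, u, u', w.
Qed.

Lemma tprodPr c u w w' : tprod u (c *: w + w') = c *: tprod u w + tprod u w'.
Proof.
rewrite /tprod /pgen -linearP; apply/lpiE; apply: span_gen.
by right; exists c, u, w, w'.
Qed.

Lemma tensor_span z : span (fun y => exists u w, y = tprod u w) z.
Proof.
elim: (pres_span z) => [_ [[u w] ->]||c x y _ ? _ ?].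
- by apply: span_gen; exists u, w.
- exact: span_zero.
- exact: span_lin.
Qed.

Lemma tensor_lift (Z : lmodType K) (F : U -> W -> Z) :
  (forall c u u' w, F (c *: u + u') w = c *: F u w + F u' w) ->
  (forall c u w w', F u (c *: w + w') = c *: F u w + F u w') ->
  exists f : {linear tensor -> Z}, forall u w, f (tprod u w) = F u w.
Proof.
move=> Fl Fr.
have [|f fE] := @pres_lift _ _ tensor_rel Z (fun x => F x.1 x.2).
  move=> _ [[c [u [u' [w ->]]]]|[c [u [w [w' ->]]]]];
  by rewrite linearB linearP /= !malg_extU /= ?Fl ?Fr subrr.
by exists f => u w; rewrite fE.
Qed.
End Tensor.
Arguments tprod {K U W}.
Notation "u ⊗ w" := (tprod u w) (at level 38, left associativity) : ring_scope.

Section TensorSpace.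
Variables (K : fieldType) (V : lmodType K).
Local Notation gen s := (mkmalgU s 1 : malg (seq V) K).

(* The reduced tensor space: [:: v1; ..; vp] stands for v1 ⊗ .. ⊗ vp, and the
   relations are multilinearity in each factor; the word of length 0 is
   killed. The other relations preserve the length p, so that this is the
   direct sum of the V^⊗p for p >= 1: by tens_lift, linear maps out of it are
   families of p-linear maps on V. *)
Definition tens_rel : malg (seq V) K -> Prop := fun r =>
  r = gen [::] \/
  exists s t c u v, r = gen (s ++ (c *: u + v) :: t)
                        - (c *: gen (s ++ u :: t) + gen (s ++ v :: t)).

Definition tspace : lmodType K := pres tens_rel.
Definition tens (s : seq V) : tspace := pgen tens_rel s.

Definition seq_multilinear (W : lmodType K) (F : seq V -> W) :=
  forall s t c u v,
    F (s ++ (c *: u + v) :: t) = c *: F (s ++ u :: t) + F (s ++ v :: t).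

Lemma tens0 : tens [::] = 0.
Proof.
rewrite -(linear0 (lpi tens_rel)); apply/lpiE; rewrite subr0.
by apply: span_gen; left.
Qed.

Lemma tens_multilinear : seq_multilinear tens.
Proof.
move=> s t c u v; rewrite /tens /pgen -linearP; apply/lpiE; apply: span_gen.
by right; exists s, t, c, u, v.
Qed.

Lemma tens_span z : span (fun y => exists s, y = tens s) z.
Proof. exact: pres_span. Qed.

Lemma tens_lift (W : lmodType K) (F : seq V -> W) :
  F [::] = 0 -> seq_multilinear F ->
  exists f : {linear tspace -> W}, forall s, f (tens s) = F s.
Proof.
move=> F0 Fl; apply: pres_lift => _ [->|[s [t [c [u [v ->]]]]]].
  by rewrite malg_extU.
by rewrite linearB linearP /= !malg_extU Fl subrr.
Qed.

Fact tens_pr_exists : {f : {linear tspace -> V} |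
  forall s, f (tens s) = if s is [:: v] then v else 0}.
Proof.
apply: cid; apply: tens_lift => // -[|x [|y s]] t c u v /=; last by rewrite scaler0 addr0.
- by case: t => //; rewrite scaler0 addr0.
- by case: t => //; rewrite scaler0 addr0.
Qed.

Definition tens_pr : {linear tspace -> V} := sval tens_pr_exists.

Lemma tens_prE s : tens_pr (tens s) = if s is [:: v] then v else 0.
Proof. exact: (svalP tens_pr_exists). Qed.
End TensorSpace.

Section Degree.
Variable n : nat.
Implicit Types a b : 'rV[int]_n.

Definition dotz a b : int := \sum_i a 0 i * b 0 i.

Definition ksign (K : fieldType) a b : K := (-1) ^ dotz a b.
End Degree.

(* A grading is an internal direct sum decomposition. *)
Record gradedSpace (K : fieldType) (n : nat) := GradedSpace {
  gcarrier :> lmodType K;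
  homog : 'rV[int]_n -> gcarrier -> Prop;
  homog0 : forall d, homog d 0;
  homogP : forall d c x y, homog d x -> homog d y -> homog d (c *: x + y);
  homog_span : forall x, exists (s : {fset 'rV[int]_n}) f,
    (forall d, homog d (f d)) /\ x = \sum_(d <- s) f d;
  homog_indep : forall (s : {fset 'rV[int]_n}) f,
    (forall d, homog d (f d)) -> \sum_(d <- s) f d = 0 ->
    forall d, d \in s -> f d = 0 }.

Section GradedTheory.
Variables (K : fieldType) (n : nat) (V : gradedSpace K n).
Local Notation Z := 'rV[int]_n.

Fact gproj_exists : exists P : Z -> V -> V, [/\ forall d, linear (P d),
  forall d x, homog d (P d x),
  forall d x, homog d x -> P d x = x,
  forall d e x, homog e x -> d != e -> P d x = 0 &
  forall x, exists s : {fset Z}, (forall d, d \notin s -> P d x = 0)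
     /\ x = \sum_(d <- s) P d x].
Proof.
pose dec (x : V) (f : Z -> V) := (forall d, homog d (f d)) /\
  exists s : {fset Z}, (forall d, d \notin s -> f d = 0) /\ x = \sum_(d <- s) f d.
have ext (f : Z -> V) (s s' : {fset Z}) : (forall d, d \notin s -> f d = 0) ->
    (s `<=` s')%fset -> \sum_(d <- s) f d = \sum_(d <- s') f d.
  by move=> f0 le; apply: big_fset_incl => // d _; exact: f0.
have decE x : exists f, dec x f.
  have [s [f [hf xE]]] := homog_span x.
  exists (fun d => if d \in s then f d else 0); split=> [d|].
    by case: ifP => // _; exact: homog0.
  exists s; split=> [d /negPf-> //|]; rewrite xE.
  by rewrite big_seq [RHS]big_seq; apply: eq_bigr => d ->.
have declin c x y f g : dec x f -> dec y g ->
    dec (c *: x + y) (fun d => c *: f d + g d).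
  move=> [hf [s [fs xE]]] [hg [t [gt yE]]]; split=> [d|]; first exact: homogP.
  exists (s `|` t)%fset; split=> [d|].
    rewrite in_fsetU negb_or => /andP[/fs-> /gt->].
    by rewrite scaler0 addr0.
  rewrite big_split -scaler_sumr /= {1}xE {1}yE.
  by rewrite (ext f s _ fs (fsubsetUl _ t)) (ext g t _ gt (fsubsetUr s _)).
have dec0 f : dec 0 f -> forall d, f d = 0.
  move=> [hf [s [f0 E]]] d; have [ds|/f0//] := boolP (d \in s).
  by apply: (homog_indep hf (esym E)).
have decU x f g : dec x f -> dec x g -> forall d, f d = g d.
  move=> xf xg d; have := declin (-1) _ _ _ _ xf xg; rewrite scaleN1r addNr.
  by move=> /dec0/(_ d)/eqP; rewrite scaleN1r addrC subr_eq0 => /eqP.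
have dech e x : homog e x -> dec x (fun d => if d == e then x else 0).
  move=> hx; split=> [d|]; first by case: eqP => [->//|_]; exact: homog0.
  exists [fset e]%fset; split=> [d|]; last by rewrite big_seq_fset1 eqxx.
  by rewrite in_fset1 => /negPf->.
have [f fP] := choice decE.
exists (fun d x => f x d); split.
- by move=> d c x y; apply: decU (fP _) (declin _ _ _ _ _ (fP x) (fP y)) d.
- by move=> d x; case: (fP x).
- by move=> d x /dech/(decU _ _ _ (fP x))->; rewrite eqxx.
- by move=> d e x /dech/(decU _ _ _ (fP x))-> /negPf->.
- by move=> x; case: (fP x).
Qed.

(* A word in seq (Z * V) carries a degree with each of its vectors, so that a
   formula with Koszul signs is multilinear in the vectors alone. *)
Definition deg_multilinear (W : lmodType K) (F : seq (Z * V) -> W) :=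
  forall s t d c u v,
    F (s ++ (d, c *: u + v) :: t) = c *: F (s ++ (d, u) :: t) + F (s ++ (d, v) :: t).

Definition homog_word (w : seq (Z * V)) := forall z, z \in w -> homog z.1 z.2.

Lemma tens_homog_lift (W : lmodType K) (F : seq (Z * V) -> W) :
  F [::] = 0 -> deg_multilinear F ->
  exists f : {linear tspace V -> W},
    forall w, homog_word w -> f (tens (unzip2 w)) = F w.
Proof.
have [P [Pl Ph P1 P0 Ps]] := gproj_exists.
have [S SP] := choice Ps.
pose fix ext (F : seq (Z * V) -> W) (s : seq V) : W :=
  if s is v :: s' then \sum_(d <- S v) ext (fun t => F ((d, P d v) :: t)) s'
  else F [::].
have ext_lin c F1 G H s : (forall t, H t = c *: F1 t + G t) ->
    ext H s = c *: ext F1 s + ext G s.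
  elim: s F1 G H => [|v s IH] F1 G H E /=; first exact: E.
  rewrite scaler_sumr -big_split; apply: eq_bigr => d _; exact: IH.
have ext0 F1 s : (forall t, F1 t = 0) -> ext F1 s = 0.
  elim: s F1 => [|v s IH] F1 E /=; first exact: E.
  by rewrite big1 // => d _; exact: IH.
have F0 F1 s d t : deg_multilinear F1 -> F1 (s ++ (d, 0) :: t) = 0.
  move=> /(_ s t d 1 0 0); rewrite !scale1r addr0 => /eqP.
  by rewrite -subr_eq0 opprD addNKr oppr_eq0 => /eqP.
have extw F1 v s (D : {fset Z}) : deg_multilinear F1 -> (S v `<=` D)%fset ->
    ext F1 (v :: s) = \sum_(d <- D) ext (fun t => F1 ((d, P d v) :: t)) s.
  move=> F1l le /=; apply: big_fset_incl => // d _ dS; apply: ext0 => t.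
  by rewrite (SP v).1 // (F0 _ _ [::]).
have shift F1 z : deg_multilinear F1 -> deg_multilinear (fun t => F1 (z :: t)).
  by move=> F1l s t d c u v; exact: (F1l (z :: s)).
have extl F1 : deg_multilinear F1 -> seq_multilinear (ext F1).
  move=> F1l s; elim: s F1 F1l => [|x s IH] F1 F1l t c u v; last first.
    rewrite /= scaler_sumr -big_split; apply: eq_bigr => d _.
    exact/IH/shift.
  rewrite !cat0s; pose D := (S u `|` S v `|` S (c *: u + v)%R)%fset.
  rewrite !(extw F1 _ _ D) //; last 3 first.
  - by rewrite /D; apply: fsubset_trans (fsubsetUl _ _); exact: fsubsetUr.
  - by rewrite /D; apply: fsubset_trans (fsubsetUl _ _); exact: fsubsetUl.
  - exact: fsubsetUr.
  rewrite scaler_sumr -big_split; apply: eq_bigr => d _.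
  by apply: ext_lin => r; rewrite Pl; exact: (F1l [::]).
have exth F1 w : deg_multilinear F1 -> homog_word w -> ext F1 (unzip2 w) = F1 w.
  elim: w F1 => [//|[d x] w IH] F1 F1l hw.
  have hx : homog d x by apply: (hw (d, x)); rewrite mem_head.
  have hw' : homog_word w by move=> z zw; apply: hw; rewrite in_cons zw orbT.
  have -> : unzip2 ((d, x) :: w) = x :: unzip2 w by [].
  rewrite (extw _ _ _ (d |` S x)%fset) ?fsubsetU1 //.
  rewrite (big_fsetD1 d) ?fset1U1 //= big1_fset => [|e].
    by rewrite addr0 P1 // IH //; exact: shift.
  rewrite !inE => /andP[ed _] _; apply: ext0 => t.
  by rewrite (P0 _ _ _ hx ed) (F0 _ _ [::]).
move=> Fnil Fl; have [f fE] := tens_lift Fnil (extl _ Fl).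
by exists f => w hw; rewrite fE exth.
Qed.

Lemma tens_homog_span z :
  span (fun y => exists2 w, homog_word w & y = tens (unzip2 w)) z.
Proof.
have [P [Pl Ph P1 P0 Ps]] := gproj_exists.
elim: (tens_span z) => [_ [s ->]||c x y _ ? _ ?]; last exact: span_lin.
  2: exact: span_zero.
suff H w : homog_word w -> span (fun y => exists2 w0, homog_word w0 &
    y = tens (unzip2 w0)) (tens (unzip2 w ++ s)) by apply: (H [::]).
elim: s w => [|v s IH] w hw; first by rewrite cats0; apply: span_gen; exists w.
have [D [_ vE]] := Ps v; rewrite vE.
elim: (enum_fset D) => [|d r IHr].
  rewrite big_nil; have := tens_multilinear (unzip2 w) s 1 0 0.
  rewrite !scale1r addr0 => /eqP.
  rewrite -subr_eq0 opprD addNKr oppr_eq0 => /eqP->; exact: span_zero.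
rewrite big_cons -[P d v]scale1r tens_multilinear; apply: span_lin => //.
rewrite -cat_rcons; have := IH (rcons w (d, P d v)).
rewrite /unzip2 map_rcons /=; apply=> z'.
by rewrite mem_rcons in_cons => /orP[/eqP->|/hw//]; exact: Ph.
Qed.

Definition tens_homog (d : Z) : tspace V -> Prop :=
  span (fun y => exists2 w, homog_word w &
                   \sum_(z <- w) z.1 = d /\ y = tens (unzip2 w)).

Fact tens_proj_exists : exists P : Z -> {linear tspace V -> tspace V},
  forall d e x, tens_homog e x -> P d x = if d == e then x else 0.
Proof.
suff: forall d, exists P : {linear tspace V -> tspace V},
    forall e x, tens_homog e x -> P x = if d == e then x else 0.
  by move=> /choice[P PE]; exists P.
move=> d; pose F w : tspace V := if d == \sum_(z <- w) z.1 then tens (unzip2 w) else 0.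
have [||f fE] := @tens_homog_lift _ F.
- by rewrite /F tens0 if_same.
- move=> s t e c u v; rewrite /F !big_cat !big_cons /=.
  rewrite /unzip2 !map_cat /= tens_multilinear.
  by case: ifP => // _; rewrite scaler0 addr0.
exists f => e x; elim=> {x} [x [w hw [<- ->]]||c x y _ fx _ fy].
- by rewrite fE.
- by rewrite linear0 if_same.
- by rewrite linearP fx fy; case: ifP => // _; rewrite scaler0 addr0.
Qed.

Fact tens_homog_dec x : exists (s : {fset Z}) f,
  (forall d, tens_homog d (f d)) /\ x = \sum_(d <- s) f d.
Proof.
have ext (f : Z -> tspace V) (s s' : {fset Z}) : (forall d, d \notin s -> f d = 0) ->
    (s `<=` s')%fset -> \sum_(d <- s) f d = \sum_(d <- s') f d.
  by move=> f0 le; apply: big_fset_incl => // d _; exact: f0.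
suff [s [f [hf _ xE]]] : exists (s : {fset Z}) f,
  [/\ forall d, tens_homog d (f d), forall d, d \notin s -> f d = 0 &
      x = \sum_(d <- s) f d] by exists s, f.
elim: (tens_homog_span x) => {x} [_ [w hw ->]||c x y _].
- set e := \sum_(z <- w) z.1.
  exists [fset e]%fset, (fun d => if d == e then tens (unzip2 w) else 0).
  split=> [d|d|]; last by rewrite big_seq_fset1 eqxx.
    case: eqP => [->|_]; last exact: span_zero.
    by apply: span_gen; exists w.
  by rewrite in_fset1 => /negPf->.
- exists fset0, (fun=> 0); split=> // [d|]; first exact: span_zero.
  by rewrite big_seq_fset0.
move=> [s [f [hf fs ->]]] _ [t [g [hg gt ->]]].
exists (s `|` t)%fset, (fun d => c *: f d + g d); split=> [d|d|].
- exact: (span_lin c (hf d) (hg d)).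
- rewrite in_fsetU negb_or => /andP[/fs-> /gt->].
  by rewrite scaler0 addr0.
rewrite big_split -scaler_sumr /=.
by rewrite (ext f s _ fs (fsubsetUl _ t)) (ext g t _ gt (fsubsetUr s _)).
Qed.

Fact tens_homog_indep (s : {fset Z}) f :
  (forall d, tens_homog d (f d)) -> \sum_(d <- s) f d = 0 ->
  forall d, d \in s -> f d = 0.
Proof.
have [P PE] := tens_proj_exists => hf E d ds.
have := linear0 (P d); rewrite -E linear_sum (big_fsetD1 d) //= (PE _ d) // eqxx.
rewrite big1_fset ?addr0 // => e; rewrite !inE => /andP[ed _] _.
by rewrite (PE _ e) // eq_sym (negPf ed).
Qed.

Definition tgraded : gradedSpace K n :=
  @GradedSpace K n (tspace V) tens_homog (fun d => span_zero _)
    (fun d c x y hx hy => span_lin c hx hy) tens_homog_dec tens_homog_indep.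

End GradedTheory.

Canonical tgraded.

Section LinearSpace.
Variables (K : fieldType) (U W : lmodType K).
Implicit Types f g h : {linear U -> W}.

Lemma linearmapP f g : f =1 g -> f = g.
Proof.
case: f g => [f [[m1] [m2]]] [g [[m3] [m4]]] /= /funext fg; subst g.
by congr (GRing.Linear.Pack (GRing.Linear.Class _ _)); congr (_ _);
  exact: Prop_irrelevance.
Qed.

HB.instance Definition _ := gen_eqMixin {linear U -> W}.
HB.instance Definition _ := gen_choiceMixin {linear U -> W}.

Let add f g : {linear U -> W} := f \+ g.
Let opp f : {linear U -> W} := \- f.
Let scale c f : {linear U -> W} := c \*: f.
Fact linmap_addA : associative add.
Proof. by move=> f g h; apply: linearmapP => x /=; rewrite addrA. Qed.
Fact linmap_addC : commutative add.
Proof. by move=> f g; apply: linearmapP => x /=; rewrite addrC. Qed.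
Fact linmap_add0 : left_id (\0 : {linear U -> W}) add.
Proof. by move=> f; apply: linearmapP => x /=; rewrite add0r. Qed.
Fact linmap_addN : left_inverse (\0 : {linear U -> W}) opp add.
Proof. by move=> f; apply: linearmapP => x /=; rewrite addNr. Qed.
HB.instance Definition _ := GRing.isZmodule.Build {linear U -> W}
  linmap_addA linmap_addC linmap_add0 linmap_addN.
Fact linmap_scaleA a b f : scale a (scale b f) = scale (a * b) f.
Proof. by apply: linearmapP => x /=; rewrite scalerA. Qed.
Fact linmap_scale1 : left_id 1 scale.
Proof. by move=> f; apply: linearmapP => x /=; rewrite scale1r. Qed.
Fact linmap_scaleDr : right_distributive scale +%R.
Proof. by move=> c f g; apply: linearmapP => x /=; rewrite scalerDr. Qed.
Fact linmap_scaleDl f : {morph scale^~ f : a b / a + b}.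
Proof. by move=> a b; apply: linearmapP => x /=; rewrite scalerDl. Qed.
HB.instance Definition _ := GRing.Zmodule_isLmodule.Build K {linear U -> W}
  linmap_scaleA linmap_scale1 linmap_scaleDr linmap_scaleDl.

Lemma linmap_linE c f g x : (c *: f + g) x = c *: f x + g x.
Proof. by []. Qed.
Lemma linmap0E x : (0 : {linear U -> W}) x = 0.
Proof. by []. Qed.
End LinearSpace.

Section DependentProduct.
Variables (K : fieldType) (M : nat -> lmodType K).

Definition dprod := forall a, M a.
HB.instance Definition _ := Choice.on dprod.
Implicit Types f g h : dprod.
Let zero : dprod := fun=> 0.
Let add f g : dprod := fun a => f a + g a.
Let opp f : dprod := fun a => - f a.
Let scale c f : dprod := fun a => c *: f a.
Fact dprod_addA : associative add.
Proof. by move=> f g h; apply: functional_extensionality_dep => a; rewrite /add addrA. Qed.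
Fact dprod_addC : commutative add.
Proof. by move=> f g; apply: functional_extensionality_dep => a; rewrite /add addrC. Qed.
Fact dprod_add0 : left_id zero add.
Proof. by move=> f; apply: functional_extensionality_dep => a; rewrite /add add0r. Qed.
Fact dprod_addN : left_inverse zero opp add.
Proof. by move=> f; apply: functional_extensionality_dep => a; rewrite /add addNr. Qed.
HB.instance Definition _ := GRing.isZmodule.Build dprod
  dprod_addA dprod_addC dprod_add0 dprod_addN.
Fact dprod_scaleA a b f : scale a (scale b f) = scale (a * b) f.
Proof. by apply: functional_extensionality_dep => i; rewrite /scale scalerA. Qed.
Fact dprod_scale1 : left_id 1 scale.
Proof. by move=> f; apply: functional_extensionality_dep => i; rewrite /scale scale1r. Qed.
Fact dprod_scaleDr : right_distributive scale +%R.
Proof. by move=> c f g; apply: functional_extensionality_dep => i; rewrite /scale scalerDr. Qed.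
Fact dprod_scaleDl f : {morph scale^~ f : a b / a + b}.
Proof. by move=> a b; apply: functional_extensionality_dep => i; rewrite /scale scalerDl. Qed.
HB.instance Definition _ := GRing.Zmodule_isLmodule.Build K dprod
  dprod_scaleA dprod_scale1 dprod_scaleDr dprod_scaleDl.
End DependentProduct.

Section GradedMaps.
Variables (K : fieldType) (n : nat).
Local Notation Z := 'rV[int]_n.

Definition has_weight (U W : gradedSpace K n) (A : Z) (f : U -> W) :=
  forall d x, homog d x -> homog (d + A) (f x).

Lemma homog_scaling (U : gradedSpace K n) (c : Z -> K) :
  exists s : {linear U -> U}, forall d u, homog d u -> s u = c d *: u.
Proof.
have [P [Pl Ph P1 P0 Ps]] := gproj_exists U.
have [S SP] := choice Ps.
pose s u := \sum_(d <- S u) c d *: P d u.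
have sD (D : {fset Z}) u : (S u `<=` D)%fset -> s u = \sum_(d <- D) c d *: P d u.
  move=> le; apply: big_fset_incl => // d _ dS.
  by rewrite (SP u).1 // scaler0.
have sl : linear s.
  move=> a x y; pose D := (S x `|` S y `|` S (a *: x + y)%R)%fset.
  rewrite !(sD D); last 3 first.
  - by rewrite /D; apply: fsubset_trans (fsubsetUl _ _); exact: fsubsetUr.
  - by rewrite /D; apply: fsubset_trans (fsubsetUl _ _); exact: fsubsetUl.
  - exact: fsubsetUr.
  rewrite scaler_sumr -big_split; apply: eq_bigr => d _ /=.
  by rewrite Pl scalerDr !scalerA mulrC.
pose ms := GRing.isLinear.Build K U U _ s sl.
pose s' : {linear U -> U} := HB.pack s ms.
exists s' => d u hu; rewrite -[LHS]/(s u) (sD (d |` S u)%fset) ?fsubsetU1 //.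
rewrite (big_fsetD1 d) ?fset1U1 //= big1_fset => [|e].
  by rewrite addr0 P1.
rewrite !inE => /andP[ed _] _.
by rewrite (P0 _ _ _ hu ed) scaler0.
Qed.

Lemma tprodZl (U W : lmodType K) c (u : U) (w : W) : (c *: u) ⊗ w = c *: (u ⊗ w).
Proof.
have E0 : (0 : U) ⊗ w = 0.
  have /eqP := tprodPl 1 (0 : U) 0 w.
  by rewrite !scale1r addr0 -subr_eq0 opprD addNKr oppr_eq0 => /eqP.
by have := tprodPl c u 0 w; rewrite addr0 E0 addr0.
Qed.

Lemma homog_sum_span (U : gradedSpace K n) (x : U) :
  span (fun y => exists d, homog d y) x.
Proof.
have [s [f [hf ->]]] := homog_span x; elim: (enum_fset s) => [|d r IH].
  by rewrite big_nil; exact: span_zero.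
by rewrite big_cons; apply: spanD => //; apply: span_gen; exists d.
Qed.

Lemma tensor_homog_span (U : gradedSpace K n) (W : lmodType K) (z : tensor U W) :
  span (fun y => exists d (u : U) w, homog d u /\ y = u ⊗ w) z.
Proof.
elim: (tensor_span z) => {z} [_ [u [w ->]]||c x y _ ? _ ?].
- elim: (homog_sum_span u) => {u} [u [d hu]||c x y _ ? _ ?].
  + by apply: span_gen; exists d, u, w.
  + by rewrite -[0 in X in span _ X](scale0r 0) tprodZl scale0r; exact: span_zero.
  + by rewrite tprodPl; exact: span_lin.
- exact: span_zero.
- exact: span_lin.
Qed.

Section GradedTensor.
Variables (U : gradedSpace K n) (U' W W' : lmodType K).
Variables (b : Z) (f : {linear U -> U'}) (g : {linear W -> W'}).

Fact gtens_exists : {h : {linear tensor U W -> tensor U' W'} |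
  forall d u w, homog d u -> h (u ⊗ w) = ksign K b d *: (f u ⊗ g w)}.
Proof.
apply: cid; have [s sE] := homog_scaling U (ksign K b).
have [||h hE] := @tensor_lift _ U W (tensor U' W') (fun u w => f (s u) ⊗ g w).
- by move=> c u u' w; rewrite !linearP tprodPl.
- by move=> c u w w'; rewrite linearP tprodPr.
by exists h => d u w hu; rewrite hE (sE _ _ hu) linearZ tprodZl.
Qed.

(* f ⊗ g with the Koszul sign, where b is the weight of g; the formula
   determines it because the u ⊗ w with u homogeneous span (tensor_homog_span). *)
Definition gtens : {linear tensor U W -> tensor U' W'} := sval gtens_exists.

Lemma gtensE d u w : homog d u -> gtens (u ⊗ w) = ksign K b d *: (f u ⊗ g w).
Proof. exact: (svalP gtens_exists). Qed.
End GradedTensor.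

Lemma gtens_linl (U : gradedSpace K n) (U' W W' : lmodType K) b c
    (f f' : {linear U -> U'}) (g : {linear W -> W'}) x :
  gtens b (c *: f + f') g x = c *: gtens b f g x + gtens b f' g x.
Proof.
rewrite -linmap_linE; apply: span_linear (tensor_homog_span x) => {x}.
move=> _ [d [u [w [hu ->]]]]; rewrite linmap_linE !(gtensE _ _ _ _ hu).
by rewrite linmap_linE tprodPl scalerDr !scalerA mulrC.
Qed.

Lemma gtens_linr (U : gradedSpace K n) (U' W W' : lmodType K) b c
    (f : {linear U -> U'}) (g g' : {linear W -> W'}) x :
  gtens b f (c *: g + g') x = c *: gtens b f g x + gtens b f g' x.
Proof.
rewrite -linmap_linE; apply: span_linear (tensor_homog_span x) => {x}.
move=> _ [d [u [w [hu ->]]]]; rewrite linmap_linE !(gtensE _ _ _ _ hu).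
by rewrite linmap_linE tprodPr scalerDr !scalerA mulrC.
Qed.

Lemma gtens0l (U : gradedSpace K n) (U' W W' : lmodType K) b
    (f : {linear U -> U'}) (g : {linear W -> W'}) x :
  (forall u, f u = 0) -> gtens b f g x = 0.
Proof.
move=> f0; apply: (@span_linear _ _ _ _ (\0 : {linear _ -> _}) _ _ _ (tensor_homog_span x)).
move=> _ [d [u [w [hu ->]]]]; rewrite (gtensE _ _ _ _ hu) f0.
by rewrite -[X in X ⊗ _](scale0r (0 : U')) tprodZl scale0r scaler0.
Qed.

Lemma gtens0r (U : gradedSpace K n) (U' W W' : lmodType K) b
    (f : {linear U -> U'}) (g : {linear W -> W'}) x :
  (forall w, g w = 0) -> gtens b f g x = 0.
Proof.
move=> g0; apply: (@span_linear _ _ _ _ (\0 : {linear _ -> _}) _ _ _ (tensor_homog_span x)).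
move=> _ [d [u [w [hu ->]]]]; rewrite (gtensE _ _ _ _ hu) g0.
have /eqP := tprodPr 1 (f u) (0 : W') 0.
by rewrite !scale1r addr0 -subr_eq0 opprD addNKr oppr_eq0 => /eqP->; rewrite scaler0.
Qed.

Variable V : gradedSpace K n.
Local Notation T := (tspace V).

Section Words.
Variable p : nat.
Implicit Types (I J : {set 'I_p}) (d : 'I_p -> Z) (v : 'I_p -> V).

Definition subword v I : #|I|.-tuple V := [tuple of [seq v i | i <- enum I]].

(* The sign of sorting the word s of distinct indices into increasing order:
   each inversion (i before j, j < i) exchanges vectors of degrees d i, d j. *)
Fixpoint koszul d (s : seq 'I_p) : K :=
  if s is i :: s' then
    (\prod_(j <- s' | (j < i)%N) ksign K (d i) (d j)) * koszul d s'
  else 1.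

Definition koszul2 d I J : K := koszul d (enum I ++ enum J).
End Words.

(* Indices start at 0: the vectors v_1, .., v_(p+1) are v 0, .., v ord_max. *)
Definition coprod_formula p (d : 'I_p.+1 -> Z) (v : 'I_p.+1 -> V) : tensor T T :=
  \sum_(I : {set 'I_p.+1}) \sum_(J : {set 'I_p.+1} |
        [&& I :|: J == [set~ ord_max], [disjoint I & J] & I != set0])
    koszul2 d I J *:
      (tens (subword v I) ⊗ tens (rcons (subword v J) (v ord_max))).

Definition updf p (v : 'I_p -> V) (i : 'I_p) (x : V) : 'I_p -> V :=
  fun j => if j == i then x else v j.

Lemma subword_updf_notin p (v : 'I_p -> V) i x (I : {set 'I_p}) : i \notin I ->
  [seq updf v i x j | j <- enum I] = [seq v j | j <- enum I].
Proof.
move=> iI; apply/eq_in_map => j; rewrite mem_enum => jI.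
by rewrite /updf; case: eqP jI iI => // -> ->.
Qed.

Lemma subword_updf_in p (v : 'I_p -> V) i (I : {set 'I_p}) : i \in I ->
  exists s t, forall x, [seq updf v i x j | j <- enum I] = s ++ x :: t.
Proof.
move=> iI; have := enum_uniq I; have : i \in enum I by rewrite mem_enum.
case/splitPr: (enum I) / => s t.
rewrite cat_uniq /= negb_or => /and4P[_ /andP[is1 _] it _].
exists (map v s), (map v t) => x.
have E r : i \notin r -> map (updf v i x) r = map v r.
  move=> ir; apply/eq_in_map => j jr; rewrite /updf.
  by case: eqP jr ir => // -> ->.
by rewrite map_cat /= !E // {1}/updf eqxx.
Qed.

Lemma coprod_formula_lin p (d : 'I_p.+1 -> Z) (v : 'I_p.+1 -> V) i c x y :
  coprod_formula d (updf v i (c *: x + y)) =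
  c *: coprod_formula d (updf v i x) + coprod_formula d (updf v i y).
Proof.
rewrite /coprod_formula scaler_sumr -big_split; apply: eq_bigr => I _ /=.
rewrite scaler_sumr -big_split; apply: eq_bigr => J /and3P[/eqP IJ dIJ _] /=.
rewrite scalerA mulrC -scalerA -scalerDr; congr (_ *: _).
have maxIJ : ord_max \notin I :|: J by rewrite IJ !inE eqxx.
have [iI|iI] := boolP (i \in I).
  have iJ : i \notin J by rewrite (disjointFr dIJ).
  have imax : ord_max == i = false.
    by apply: contraNF maxIJ => /eqP->; rewrite inE iI.
  have [s [t E]] := subword_updf_in v iI.
  by rewrite !(subword_updf_notin _ _ iJ) !E /updf imax tens_multilinear tprodPl.
rewrite !(subword_updf_notin _ _ iI).
have [iJ|iJ] := boolP (i \in J).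
  have imax : ord_max == i = false.
    by apply: contraNF maxIJ => /eqP->; rewrite inE iJ orbT.
  have [s [t E]] := subword_updf_in v iJ.
  by rewrite !E /updf imax !rcons_cat /= tens_multilinear tprodPr.
have -> : i = ord_max.
  apply/eqP; have : i \notin I :|: J by rewrite inE negb_or iI.
  by rewrite IJ !inE negbK.
rewrite !subword_updf_notin; [|by move: maxIJ; rewrite inE negb_or => /andP[]..].
by rewrite /updf eqxx -!cats1 tens_multilinear tprodPr.
Qed.

Fact coprod_exists : {D : {linear T -> tensor T T} |
  forall p (d : 'I_p.+1 -> Z) (v : 'I_p.+1 -> V), (forall i, homog (d i) (v i)) ->
    D (tens [tuple v i | i < p.+1]) = coprod_formula d v}.
Proof.
apply: cid; have [G GE] : exists G : forall q, (nat -> Z * V) -> tensor T T, forall q e,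
    G q e = coprod_formula (fun i : 'I_q.+1 => (e i).1) (fun i => (e i).2).
  by exists (fun q e => coprod_formula (fun i : 'I_q.+1 => (e i).1) (fun i => (e i).2)).
pose F (w : seq (Z * V)) : tensor T T :=
  if size w is q.+1 then G q (nth (0, 0) w) else 0.
have Fl : deg_multilinear F.
  move=> s t d c u v; rewrite /F !size_cat /= !addnS.
  set q := (size s + size t)%N.
  have sq : (size s < q.+1)%N by rewrite ltnS leq_addr.
  pose w0 := s ++ (d, 0) :: t.
  have nE x (i : 'I_q.+1) : nth (0, 0) (s ++ (d, x) :: t) i =
      ((nth (0, 0) w0 i).1, updf (fun i => (nth (0, 0) w0 i).2) (Ordinal sq) x i).
    rewrite /updf -val_eqE /= /w0 !nth_cat; case: ltngtP => [||->] //.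
    - by case: (nth _ s i).
    - by rewrite -subn_gt0; case: (i - size s)%N => //= k _; case: (nth _ t k).
    - by rewrite subnn.
  have E x : G q (nth (0, 0) (s ++ (d, x) :: t)) =
     coprod_formula (fun i : 'I_q.+1 => (nth (0, 0) w0 i).1)
       (updf (fun i => (nth (0, 0) w0 i).2) (Ordinal sq) x).
    rewrite GE; apply: (f_equal2 (@coprod_formula q)); apply/funext => i.
      by rewrite nE.
    by rewrite nE.
  by rewrite !E coprod_formula_lin.
have [f fE] := tens_homog_lift (erefl : F [::] = 0) Fl.
exists f => p d v hv.
pose w := [seq (d i, v i) | i <- enum 'I_p.+1].
have -> : tens [tuple v i | i < p.+1] = tens (unzip2 w).
  by congr tens; rewrite /w /unzip2 -map_comp.
rewrite fE; last by move=> _ /mapP[i _ ->]; exact: hv.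
have sw : size w = p.+1 by rewrite size_map size_enum_ord.
have nw (i : 'I_p.+1) : nth (0, 0) w i = (d i, v i).
  by rewrite (nth_map i) ?size_enum_ord // nth_ord_enum.
rewrite /F sw GE.
by apply: (f_equal2 (@coprod_formula p)); apply/funext => i; rewrite nw.
Qed.

(* Determined by coprodE, because words of homogeneous vectors span
   (tens_homog_span). *)
Definition coprod : {linear T -> tensor T T} := sval coprod_exists.

Lemma coprodE p (d : 'I_p.+1 -> Z) (v : 'I_p.+1 -> V) :
  (forall i, homog (d i) (v i)) ->
  coprod (tens [tuple v i | i < p.+1]) = coprod_formula d v.
Proof. exact: (svalP coprod_exists). Qed.

Section Coder.
Variable Q : Z.

Definition is_coder (D : {linear T -> T}) : Prop :=
  has_weight Q D /\
  forall x, coprod (D x) = gtens 0 D (idfun : {linear T -> T}) (coprod x)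
                         + gtens Q (idfun : {linear T -> T}) D (coprod x).
Definition coder_pred : {pred {linear T -> T}} := fun D => `[< is_coder D >].

Record coder := Coder { coder_fun :> {linear T -> T}; _ : coder_fun \in coder_pred }.
HB.instance Definition _ := [isSub for coder_fun].
HB.instance Definition _ := [Choice of coder by <:].
Fact coder_submod_closed : submod_closed coder_pred.
Proof.
suff H c f g : f \in coder_pred -> g \in coder_pred -> c *: f + g \in coder_pred.
  split=> [|c f g]; last exact: H.
  apply/asboolP; split=> [d x _|x]; first exact: homog0.
  have e1 : gtens 0 (\0 : {linear T -> T}) (idfun : {linear T -> T}) (coprod x) = 0.
    exact: gtens0l.
  have e2 : gtens Q (idfun : {linear T -> T}) (\0 : {linear T -> T}) (coprod x) = 0.
    exact: gtens0r.
  apply: (etrans (linear0 coprod)); apply/esym.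
  by apply: (etrans (f_equal2 _ e1 e2)); rewrite addr0.
move=> /asboolP[fw fc] /asboolP[gw gc]; apply/asboolP; split=> [d x hx|x].
  by rewrite linmap_linE; apply: homogP; [exact: fw|exact: gw].
have e1 : coprod ((c *: f + g) x) = c *: coprod (f x) + coprod (g x).
  exact: (linearP coprod c (f x) (g x)).
have e2 := gtens_linl 0 c f g (idfun : {linear T -> T}) (coprod x).
have e3 := gtens_linr Q c (idfun : {linear T -> T}) f g (coprod x).
apply: (etrans e1); apply/esym; apply: (etrans (f_equal2 _ e2 e3)).
by rewrite (fc x) (gc x) scalerDr addrACA.
Qed.
HB.instance Definition _ :=
  GRing.SubChoice_isSubLmodule.Build K {linear T -> T} coder_pred coder coder_submod_closed.
End Coder.

Section Multilinear.
Variables (A : Z) (a : nat).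
Implicit Type m : a.+1.-tuple V -> V.

Definition tuple_upd (v : a.+1.-tuple V) (i : 'I_a.+1) (x : V) : a.+1.-tuple V :=
  [tuple if j == i then x else tnth v j | j < a.+1].

Definition tuple_multilinear m := forall v i c x y,
  m (tuple_upd v i (c *: x + y)) = c *: m (tuple_upd v i x) + m (tuple_upd v i y).

Definition multi_weight m := forall (d : 'I_a.+1 -> Z) v,
  (forall i, homog (d i) (tnth v i)) -> homog (\sum_i d i + A) (m v).

Definition multi_pred : {pred (a.+1.-tuple V -> V)} :=
  fun m => `[< tuple_multilinear m /\ multi_weight m >].

(* M^(A,a)(V). *)
Record multi := Multi { multi_fun :> a.+1.-tuple V -> V; _ : multi_fun \in multi_pred }.
HB.instance Definition _ := [isSub for multi_fun].
HB.instance Definition _ := [Choice of multi by <:].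
Fact multi_submod_closed : submod_closed multi_pred.
Proof.
split=> [|c f g /asboolP[fl fw] /asboolP[gl gw]].
  apply/asboolP; split=> [v i c x y|d v _]; last exact: homog0.
  have E z : (0 : a.+1.-tuple V -> V) z = 0 by [].
  by rewrite !E scaler0 addr0.
apply/asboolP; split=> [v i b x y|d v hv]; last first.
  by apply: homogP; [exact: fw|exact: gw].
have E z : (c *: f + g) z = c *: f z + g z by [].
rewrite !E fl gl !scalerDr !scalerA mulrC.
by rewrite -!scalerA addrACA.
Qed.
HB.instance Definition _ :=
  GRing.SubChoice_isSubLmodule.Build K (a.+1.-tuple V -> V) multi_pred multi multi_submod_closed.
End Multilinear.

Definition multis (Q : Z) : lmodType K := dprod (fun a => multi Q a : lmodType K).

Lemma tuple_updE a (v : a.+1.-tuple V) i x :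
  tuple_upd v i x = take i v ++ x :: drop i.+1 v :> seq V.
Proof.
have ilt := ltn_ord i.
apply: (@eq_from_nth _ 0) => [|j].
  by rewrite size_tuple size_cat /= size_take size_drop size_tuple ltn_ord; lia.
rewrite size_tuple => jlt; rewrite -[j]/(nat_of_ord (Ordinal jlt)).
rewrite -tnth_nth tnth_mktuple nth_cat size_take size_tuple ltn_ord /=.
rewrite -val_eqE /=; case: ltngtP => [ji|ij|->]; last by rewrite subnn.
  by rewrite nth_take // (tnth_nth 0).
case: (j - i)%N (subnK (ltnW ij)) => [|k] /= E; first by lia.
rewrite nth_drop (tnth_nth 0) /=; congr nth; lia.
Qed.

Lemma tens_pr_homog e x : homog e x -> homog e (tens_pr V x).
Proof.
elim=> {x} [_ [w hw [<- ->]]||c x y _ hx _ hy]; last first.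
- by rewrite linearP; exact: homogP.
- by rewrite linear0; exact: homog0.
rewrite tens_prE; case: w hw => [|[d u] [|z w]] hw /=; try exact: homog0.
by rewrite big_seq1; apply: (hw (d, u)); rewrite mem_head.
Qed.

Fact corestr_multi Q (D : coder Q) a :
  (fun v : a.+1.-tuple V => tens_pr V (D (tens v))) \in @multi_pred Q a.
Proof.
have /asboolP[Dw _] := valP D.
apply/asboolP; split=> [v i c x y|d v hv].
  by rewrite !tuple_updE tens_multilinear !linearP.
apply: tens_pr_homog; apply: (Dw (\sum_i d i)); apply: span_gen.
exists [seq (d i, tnth v i) | i <- enum 'I_a.+1].
  by move=> _ /mapP[i _ ->]; exact: hv.
rewrite big_map big_enum; split=> //.
congr tens; rewrite /unzip2 -map_comp.
by rewrite -[in LHS](map_tnth_enum v).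
Qed.

(* Component a of the product is M^(Q,a), i.e. the corestriction Q_(a+1). *)
Definition corestr Q (D : coder Q) : multis Q := fun a => Multi (@corestr_multi Q D a).

(* L plays the role of K in the unshuffle (I, J, K), and k that of its least
   element k_1, so that L is nonempty. *)
Definition coder_formula Q (m : multis Q) p (d : 'I_p -> Z) (v : 'I_p -> V) : T :=
  \sum_(I : {set 'I_p}) \sum_(J : {set 'I_p}) \sum_(L : {set 'I_p} |
        [&& I :|: J :|: L == [set: 'I_p], [disjoint I & J], [disjoint I & L]
          & [disjoint J & L]])
  \sum_(k | [&& k \in L, [forall l in L, (k <= l)%N],
              [forall i in I, (i < k)%N] & [forall j in J, (j < k)%N]])
    (koszul2 d I J * ksign K Q (\sum_(i in I) d i)) *:
      tens (subword v I
            ++ m #|J| [tuple of rcons (subword v J) (v k)] :: subword v (L :\ k)).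
End GradedMaps.

(* Main.v *)
Require Import Defs.
From HB Require Import structures.
From mathcomp Require Import boolp.
From mathcomp Require Import all_boot all_order all_algebra ring.

Set Implicit Arguments.
Unset Strict Implicit.
Unset Printing Implicit Defensive.

Import GRing.Theory.
Local Open Scope ring_scope.

(** A coderivation is determined by its corestrictions because the coproduct
    forgets only the part of a tensor that lies in V.  In Delta (v_1 ⊗ .. ⊗ v_p)
    the only term whose right factor has length one is
    (v_1 ⊗ .. ⊗ v_(p-1)) ⊗ v_p, so projecting the right factor to V and
    concatenating rebuilds every word of length p >= 2 from its coproduct: every
    x is recovered from pr x and Delta x (coprod_recover).  If D is a coderivation,
    then Delta (D w) involves D only on words shorter than w, hence D w is
    determined, by induction on the length, by the values pr (D u) for words u no
    longer than w; this is injectivity of the corestriction map (corestr_inj).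

    For surjectivity one checks that the explicit formula defines a
    coderivation.  The signed sum over all unshuffles I, J of a word (unsh) is a
    coassociative and graded cocommutative coproduct (unshA, unshC), and Delta
    is the same sum with the last letter kept on the right (half_unsh).  The
    formula for Q (insert) has a recursion on the last letter v_p of the word:
    either v_p lies in the tail after k_1 and is just appended, or k_1 = p and
    Q_(|J|+1) swallows v_p together with J while I stays in front of it.  With
    this recursion Q is shown to be a coderivation of the full unshuffle
    coproduct (insert_unsh); the two terms in which the letter that is produced
    goes left or right are matched by coassociativity, and, in the first case,
    by a graded swap.  The half coproduct follows by one more use of
    coassociativity (insert_half_unsh).

    Both recursions peel off the last letter, so words are stored from right to
    left: the head of a list is the last factor of the tensor.  These identities
    hold over any alphabet of letters with degrees and with values in any vector
    space, which allows them to be used both for words of indices, where they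
    become the sums over subsets in the statement (unsh_sets, insert_sets), and
    for words of homogeneous vectors with their degrees. *)

(** * Signed sums over unshuffles *)

Section KoszulSign.
Variables (K : fieldType) (n : nat).
Implicit Types a b c : 'rV[int]_n.

Let N1_neq0 : (-1 : K) != 0. Proof. by rewrite oppr_eq0 oner_eq0. Qed.

Lemma ksignC a b : ksign K a b = ksign K b a.
Proof. by congr (_ ^ _); apply: eq_bigr => i _; rewrite mulrC. Qed.

Lemma ksignDl a b c : ksign K (a + b) c = ksign K a c * ksign K b c.
Proof.
rewrite /ksign -expfzDr //; congr (_ ^ _).
by rewrite -big_split; apply: eq_bigr => i _; rewrite mxE mulrDl.
Qed.

Lemma ksignDr a b c : ksign K c (a + b) = ksign K c a * ksign K c b.
Proof. by rewrite !(ksignC c) ksignDl. Qed.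

Lemma ksign0r a : ksign K a 0 = 1.
Proof. by rewrite /ksign /dotz big1 // => i _; rewrite mxE mulr0. Qed.

Lemma ksign0l a : ksign K 0 a = 1.
Proof. by rewrite ksignC ksign0r. Qed.

Lemma ksignK a b : ksign K a b * ksign K a b = 1.
Proof. by rewrite /ksign -expfzMl mulrNN mulr1 exp1rz. Qed.

Lemma ksign_sumr (I : Type) (r : seq I) (P : pred I) (d : I -> 'rV[int]_n) a :
  ksign K a (\sum_(i <- r | P i) d i) = \prod_(i <- r | P i) ksign K a (d i).
Proof. by apply: (big_morph (ksign K a)); [move=> *; exact: ksignDr | exact: ksign0r]. Qed.
End KoszulSign.

Section Unshuffles.
Variables (K : fieldType) (n : nat) (X : eqType) (deg : X -> 'rV[int]_n).
Implicit Types (W : lmodType K) (w a b : seq X) (y : X).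

Definition wdeg w := \sum_(x <- w) deg x.
Local Notation "<< a , b >>" := (ksign K a b) (format "<< a ,  b >>").

(** Sum of ε(a; b) G a b over the ways to deal the letters of w to a left word a
    and a right word b.  The last letter y of the original word is the head of
    w; when it goes left it must cross the whole of b to be sorted, whence the
    sign.  The sum is kept as a functional of G so that no tensor product is
    needed to iterate it. *)
Fixpoint unsh W w (G : seq X -> seq X -> W) : W :=
  if w is y :: w' then
    unsh w' (fun a b => ksign K (wdeg b) (deg y) *: G (y :: a) b)
    + unsh w' (fun a b => G a (y :: b))
  else G [::] [::].

Lemma unsh_cons W y w (G : seq X -> seq X -> W) :
  unsh (y :: w) G = unsh w (fun a b => <<wdeg b, deg y>> *: G (y :: a) b)
                    + unsh w (fun a b => G a (y :: b)).
Proof. by []. Qed.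

Lemma wdeg_nil : wdeg [::] = 0. Proof. exact: big_nil. Qed.

Lemma wdeg_cons y w : wdeg (y :: w) = deg y + wdeg w.
Proof. exact: big_cons. Qed.

Lemma wdeg_perm a b w : perm_eq (a ++ b) w -> wdeg w = wdeg a + wdeg b.
Proof. by move=> ab; rewrite /wdeg -big_cat; apply/esym/perm_big. Qed.

Lemma eq_unsh W w (G H : seq X -> seq X -> W) :
  (forall a b, perm_eq (a ++ b) w -> G a b = H a b) -> unsh w G = unsh w H.
Proof.
elim: w G H => [|y w IH] G H E /=; first exact: E.
congr (_ + _); apply: IH => a b ab; rewrite E //=; first by rewrite perm_cons.
by rewrite -[y :: b]cat1s perm_catCA perm_cons.
Qed.

Lemma unsh_linear W w c (G H : seq X -> seq X -> W) :
  unsh w (fun a b => c *: G a b + H a b) = c *: unsh w G + unsh w H.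
Proof.
elim: w G H => [|y w IH] G H //=.
rewrite IH scalerDr addrACA; congr (_ + _); rewrite -IH.
by apply: eq_unsh => a b _; rewrite scalerDr !scalerA mulrC.
Qed.

Lemma unshD W w (G H : seq X -> seq X -> W) :
  unsh w (fun a b => G a b + H a b) = unsh w G + unsh w H.
Proof.
by rewrite -[unsh w G]scale1r -unsh_linear; apply: eq_unsh => *; rewrite scale1r.
Qed.

Lemma unsh_hom W W' (f : {linear W -> W'}) w (G : seq X -> seq X -> W) :
  f (unsh w G) = unsh w (fun a b => f (G a b)).
Proof.
elim: w G => [|y w IH] G //=; rewrite linearD !IH; congr (_ + _).
by apply: eq_unsh => *; rewrite linearZ.
Qed.

Lemma unshZ W w c (G : seq X -> seq X -> W) :
  unsh w (fun a b => c *: G a b) = c *: unsh w G.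
Proof. by rewrite (unsh_hom ( *:%R c)). Qed.

Lemma unsh0 W w (G : seq X -> seq X -> W) :
  (forall a b, perm_eq (a ++ b) w -> G a b = 0) -> unsh w G = 0.
Proof.
move=> G0; rewrite (@eq_unsh _ _ _ (fun a b => 0 *: G a b)) => [|a b /G0->].
  by rewrite unshZ scale0r.
by rewrite scaler0.
Qed.

Lemma unsh_nilr W w (G : seq X -> seq X -> W) :
  (forall a y b, G a (y :: b) = 0) -> unsh w G = G w [::].
Proof.
elim: w G => [//|y w IH] G G0 /=.
rewrite [X in _ + X]unsh0 ?addr0 // IH ?wdeg_nil ?ksign0l ?scale1r // => a z b.
by rewrite G0 scaler0.
Qed.

Lemma unsh_nill W w (G : seq X -> seq X -> W) :
  (forall a y b, G (y :: a) b = 0) -> unsh w G = G [::] w.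
Proof.
elim: w G => [//|y w IH] G G0 /=.
by rewrite unsh0 ?add0r ?IH // => a b _; rewrite G0 scaler0.
Qed.

(** Graded cocommutativity: the sign between the two arrangements of a and b is
    the exchange of the two blocks. *)
Lemma unshC W w (G : seq X -> seq X -> W) :
  unsh w G = unsh w (fun a b => <<wdeg a, wdeg b>> *: G b a).
Proof.
elim: w G => [|y w IH] G /=; first by rewrite wdeg_nil ksign0r scale1r.
rewrite addrC [X in X + _]IH [X in _ + X]IH.
congr (_ + _); apply: eq_unsh => a b _; rewrite wdeg_cons scalerA.
  rewrite ksignDl [<<deg y, _>>]ksignC.
  by rewrite mulrA ksignK mul1r.
by rewrite ksignDr mulrC.
Qed.

(** Coassociativity: both sides sum over all ways to deal w to three words, with
    the sign that sorts their concatenation. *)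
Lemma unshA W w (F : seq X -> seq X -> seq X -> W) :
  unsh w (fun a c => unsh a (fun a' b => F a' b c))
  = unsh w (fun a b => unsh b (fun b' c => F a b' c)).
Proof.
elim: w F => [//|y w IH] F /=; rewrite [in RHS]unshD.
(* The three summands are the cases where y joins the first, second or third word. *)
pose F1 a b c := <<wdeg c, deg y>> *: (<<wdeg b, deg y>> *: F (y :: a) b c).
pose F2 a b c := <<wdeg c, deg y>> *: F a (y :: b) c.
pose F3 a b c := F a b (y :: c).
transitivity (unsh w (fun a c => unsh a (fun a' b => F1 a' b c))
  + unsh w (fun a c => unsh a (fun a' b => F2 a' b c))
  + unsh w (fun a c => unsh a (fun a' b => F3 a' b c))).
  rewrite -[X in _ = X + _]unshD; congr (_ + _); apply: eq_unsh => a c _.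
  by rewrite !unshZ scalerDr.
rewrite !IH -addrA; congr (_ + _); apply: eq_unsh => a b _.
rewrite -unshZ; apply: eq_unsh => b' c bc.
by rewrite /F1 scalerA (wdeg_perm bc) ksignDl mulrC.
Qed.

(** The coproduct Delta on words: the last letter always stays on the right.  The
    term with empty left word is kept here; it vanishes in T(V), where the
    empty word is zero. *)
Definition half_unsh W w (G : seq X -> seq X -> W) : W :=
  if w is y :: w' then unsh w' (fun a b => G a (y :: b)) else 0.

Lemma eq_half_unsh W w (G H : seq X -> seq X -> W) :
  (forall a y b, perm_eq (a ++ y :: b) w -> G a (y :: b) = H a (y :: b)) ->
  half_unsh w G = half_unsh w H.
Proof.
case: w => [//|y w] E; apply: eq_unsh => a b ab; apply: E.
by rewrite -[y :: b]cat1s perm_catCA perm_cons.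
Qed.

Lemma half_unsh_hom W W' (f : {linear W -> W'}) w (G : seq X -> seq X -> W) :
  f (half_unsh w G) = half_unsh w (fun a b => f (G a b)).
Proof. by case: w => [|y w]; [exact: linear0 | exact: unsh_hom]. Qed.

Section Insertion.
Variables (Q : 'rV[int]_n) (M : seq X -> X).

(** The formula for the coderivation, where M b is the letter that the word b is
    merged into (the value of Q on it).  Either the last letter y is in the tail
    behind the merged letter, or y is the letter k_1 and the rest of the word is
    dealt to a (the indices I) and b (the indices J). *)
Fixpoint insert W w (G : seq X -> W) : W :=
  if w is y :: w' then
    insert w' (fun r => G (y :: r))
    + unsh w' (fun a b => ksign K Q (wdeg a) *: G (M (y :: b) :: a))
  else 0.

Lemma insert_cons W y w (G : seq X -> W) :
  insert (y :: w) G = insert w (fun r => G (y :: r))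
                    + unsh w (fun a b => <<Q, wdeg a>> *: G (M (y :: b) :: a)).
Proof. by []. Qed.

Lemma eq_insert W w (G H : seq X -> W) :
  (forall t y a b, perm_eq (t ++ y :: a ++ b) w ->
     G (t ++ M (y :: b) :: a) = H (t ++ M (y :: b) :: a)) ->
  insert w G = insert w H.
Proof.
elim: w G H => [//|y w IH] G H E /=; congr (_ + _).
  by apply: IH => t x a b p; rewrite -!cat_cons E //= perm_cons.
by apply: eq_unsh => a b ab; rewrite (E [::]) //= perm_cons.
Qed.

Lemma insert_linear W w c (G H : seq X -> W) :
  insert w (fun r => c *: G r + H r) = c *: insert w G + insert w H.
Proof.
elim: w G H => [|y w IH] G H /=; first by rewrite scaler0 addr0.
rewrite IH scalerDr addrACA; congr (_ + _); rewrite -unsh_linear.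
by apply: eq_unsh => a b _; rewrite scalerDr !scalerA mulrC.
Qed.

Lemma insertD W w (G H : seq X -> W) :
  insert w (fun r => G r + H r) = insert w G + insert w H.
Proof.
by rewrite -[insert w G]scale1r -insert_linear; apply: eq_insert => *; rewrite scale1r.
Qed.

Lemma insert_hom W W' (f : {linear W -> W'}) w (G : seq X -> W) :
  f (insert w G) = insert w (fun r => f (G r)).
Proof.
elim: w G => [|y w IH] G /=; first exact: linear0.
rewrite linearD IH unsh_hom; congr (_ + _).
by apply: eq_unsh => *; rewrite linearZ.
Qed.

Lemma insertZ W w c (G : seq X -> W) : insert w (fun r => c *: G r) = c *: insert w G.
Proof. by rewrite (insert_hom ( *:%R c)). Qed.

Hypothesis degM : forall y b, deg (M (y :: b)) = wdeg (y :: b) + Q.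

(** Merging is a coderivation for the full unshuffle coproduct.  In the induction
    on the last letter y, the terms where y is in the tail are the induction
    hypothesis; the others deal w to three words, of which one is merged with y. *)
Lemma insert_unsh W w (H : seq X -> seq X -> W) :
  insert w (fun r => unsh r H)
  = unsh w (fun a b => insert a (fun r => H r b))
    + unsh w (fun a b => <<Q, wdeg a>> *: insert b (fun r => H a r)).
Proof.
elim: w H => [|y w IH] H; first by rewrite /= scaler0 addr0.
rewrite insert_cons insertD !IH !unsh_cons.
have -> : unsh w (fun a b => <<Q, wdeg a>> *: unsh (M (y :: b) :: a) H)
    = unsh w (fun a b => <<Q, wdeg a>> *: unsh a (fun a' b' =>
        <<wdeg b', deg (M (y :: b))>> *: H (M (y :: b) :: a') b'))
      + unsh w (fun a b => <<Q, wdeg a>> *: unsh a (fun a' b' => H a' (M (y :: b) :: b'))).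
  by rewrite -unshD; apply: eq_unsh => a b _; rewrite /= scalerDr.
(* cross: b is merged with y and goes left, while c goes right, and y has crossed it.
   right: the word merged with y goes right. *)
pose cross a b c : W := <<wdeg c, deg y>> *: (<<Q, wdeg a>> *: H (M (y :: b) :: a) c).
pose right a b c : W := <<Q, wdeg b>> *: H a (M (y :: c) :: b).
have crossE : unsh w (fun a b => <<Q, wdeg a>> *: unsh a (fun a' b' =>
      <<wdeg b', deg (M (y :: b))>> *: H (M (y :: b) :: a') b'))
    = unsh w (fun a c => unsh a (fun a' b => cross a' b c)).
  transitivity (unsh w (fun a c => unsh a (fun a' b => <<Q, wdeg a'>> *:
      (<<Q, wdeg b>> *: (<<wdeg b, deg (M (y :: c))>> *: H (M (y :: c) :: a') b))))).
    apply: eq_unsh => a c _; rewrite -unshZ; apply: eq_unsh => a' b /wdeg_perm->.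
    by rewrite ksignDr scalerA.
  (* On the left b and c occur in the opposite order, so they must be swapped. *)
  rewrite unshA [RHS]unshA; apply: eq_unsh => a bc _; rewrite unshC.
  apply: eq_unsh => b c _; rewrite /cross degM wdeg_cons !scalerA; congr (_ *: _).
  rewrite !ksignDr [<<wdeg b, _>>]ksignC [<<Q, wdeg c>>]ksignC.
  (* The merged letter crosses c with degree deg y + deg b + Q; the swap
     undoes the part from b, and the weight of Q on c undoes the part from Q. *)
  rewrite -[RHS]mul1r -(ksignK K (wdeg c) (wdeg b)) -[RHS]mul1r.
  rewrite -(ksignK K (wdeg c) Q); ring.
have rightE : unsh w (fun a b => <<Q, wdeg a>> *: unsh a (fun a' b' =>
      H a' (M (y :: b) :: b')))
    = unsh w (fun a c => <<Q, wdeg a>> *: unsh c (fun b c => right a b c)).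
  transitivity (unsh w (fun a c => unsh a (fun a' b =>
      <<Q, wdeg a'>> *: right a' b c))).
    apply: eq_unsh => a c _; rewrite -unshZ; apply: eq_unsh => a' b /wdeg_perm->.
    by rewrite ksignDr scalerA.
  by rewrite unshA; apply: eq_unsh => a bc _; rewrite unshZ.
have crossR : unsh w (fun a b => <<wdeg b, deg y>> *: insert (y :: a) (fun r => H r b))
    = unsh w (fun a b => <<wdeg b, deg y>> *: insert a (fun r => H (y :: r) b))
      + unsh w (fun a c => unsh a (fun a' b => cross a' b c)).
  rewrite -unshD; apply: eq_unsh => a b _; rewrite insert_cons scalerDr; congr (_ + _).
  by rewrite -unshZ.
have rightR : unsh w (fun a b => <<Q, wdeg a>> *: insert (y :: b) (fun r => H a r))
    = unsh w (fun a b => <<Q, wdeg a>> *: insert b (fun r => H a (y :: r)))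
      + unsh w (fun a c => <<Q, wdeg a>> *: unsh c (fun b c => right a b c)).
  by rewrite -unshD; apply: eq_unsh => a b _; rewrite /= scalerDr.
rewrite rightR crossR -crossE -rightE.
rewrite [X in _ = X + _]addrAC [X in _ = _ + X]addrA [RHS]addrACA [X in _ = X + _]addrACA.
congr (_ + _ + _ + _).
  by apply: eq_unsh => a b _; rewrite insertZ.
apply: eq_unsh => a b _; rewrite wdeg_cons scalerA -!insertZ.
apply: eq_insert => t x a' b' p; rewrite scalerA; congr (_ *: _).
have -> : wdeg (t ++ M (x :: b') :: a') = wdeg b + Q.
  rewrite /wdeg -(perm_big _ p) !big_cat !big_cons big_cat /= degM wdeg_cons /wdeg.
  rewrite -!addrA; do 2!congr (_ + _).
  by rewrite addrA addrC.
by rewrite ksignDl ksignDr [<<Q, deg y>>]ksignC; ring.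
Qed.

(** Compared with insert_unsh, the last letter y is now held on the right.  When
    it is merged, the word a on the left of the merged letter is dealt further,
    and coassociativity regroups this as an insertion into the right word. *)
Lemma insert_half_unsh W w (G : seq X -> seq X -> W) :
  insert w (fun r => half_unsh r G)
  = half_unsh w (fun a b => insert a (fun r => G r b))
    + half_unsh w (fun a b => <<Q, wdeg a>> *: insert b (fun r => G a r)).
Proof.
case: w => [|y w]; first by rewrite /= addr0.
rewrite insert_cons (insert_unsh _ (fun a b => G a (y :: b))) /= -addrA; congr (_ + _).
have -> : unsh w (fun a b => <<Q, wdeg a>> *: unsh a (fun a' b' => G a' (M (y :: b) :: b')))
   = unsh w (fun a b => unsh b (fun b' c =>
       <<Q, wdeg a>> *: (<<Q, wdeg b'>> *: G a (M (y :: c) :: b')))).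
  rewrite -unshA; apply: eq_unsh => a c _; rewrite -unshZ.
  by apply: eq_unsh => a' b /wdeg_perm->; rewrite ksignDr scalerA.
rewrite -unshD; apply: eq_unsh => a b _; rewrite scalerDr; congr (_ + _).
exact: unshZ.
Qed.
End Insertion.
End Unshuffles.

(** * Unshuffles of an index set *)

Section IndexSets.
Variable p : nat.
Implicit Types (A I J : {set 'I_p}) (x : 'I_p).

Lemma enum_setU1_max x A : (forall i, i \in A -> (i < x)%N) ->
  enum (x |: A) = rcons (enum A) x.
Proof.
move=> ltx; have srt (B : {set _}) : sorted ltn (map val (enum B : seq 'I_p)).
  apply: (subseq_sorted ltn_trans) (map_subseq val (filter_subseq _ _)) _.
  by rewrite -enumT val_enum_ord iota_ltn_sorted.
apply: (inj_map val_inj); apply: (irr_sorted_eq ltn_trans ltnn) => //.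
  rewrite map_rcons; have := srt A; case E : (enum A) => [//|y s] /=.
  rewrite rcons_path => -> /=; rewrite last_map; apply: ltx.
  by rewrite -mem_enum E mem_last.
move=> i; rewrite map_rcons mem_rcons inE; apply/mapP/predU1P => [[j]|].
  rewrite mem_enum !inE => /predU1P[-> ->|jA ->]; [by left|right].
  by rewrite map_f // mem_enum.
case=> [->|/mapP[j jA ->]]; [exists x => //|exists j => //]; rewrite mem_enum !inE ?eqxx //.
by rewrite mem_enum in jA; rewrite jA orbT.
Qed.

(** Sets are built by adding a new maximum, which is the head of the list when
    the indices are listed from right to left. *)
Lemma set_max_ind (P : {set 'I_p} -> Prop) : P set0 ->
  (forall x A, (forall i, i \in A -> (i < x)%N) -> P A -> P (x |: A)) ->
  forall A, P A.
Proof.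
move=> P0 PU A; have [m] := ubnP #|A|; elim: m A => // m IH A.
rewrite ltnS; have [->//|[x0 x0A]] := set_0Vmem A.
case: (arg_maxnP val x0A) => x; rewrite -/(x \in A) => xA xmax leA.
rewrite -(setD1K xA); apply: PU => [i|].
  by rewrite !inE ltn_neqAle -val_eqE => /andP[-> iA]; exact: xmax.
by apply: IH; apply: leq_trans leA; rewrite [X in (_ < X)%N](cardsD1 x) xA.
Qed.

Lemma big_subsets_setU1 (W : nmodType) x A (F : {set 'I_p} -> W) : x \notin A ->
  \sum_(I : {set 'I_p} | I \subset x |: A) F I
  = \sum_(I : {set 'I_p} | I \subset A) F (x |: I) + \sum_(I : {set 'I_p} | I \subset A) F I.
Proof.
move=> xA; rewrite (bigID (fun I : {set 'I_p} => x \in I)) /=; congr (_ + _).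
  rewrite (reindex_onto (fun I => x |: I) (fun I => I :\ x)) /=; last first.
    by move=> I /andP[_ /setD1K].
  apply: eq_bigl => I; rewrite setU11 andbT.
  apply/andP/idP => [[sIA /eqP <-]|sIA].
    by rewrite subDset.
  by rewrite setUS ?setU1K // (contra (subsetP sIA x)).
apply: eq_bigl => I; apply/andP/idP => [[sIA xI]|sIA].
  by move: sIA; rewrite -subDset (setDidPl _) // disjoint_sym disjoints1.
by rewrite (subset_trans sIA) ?subsetUr // (contra (subsetP sIA x)).
Qed.

Lemma big_disjoint_cover (W : nmodType) A (F : {set 'I_p} -> {set 'I_p} -> W) :
  \sum_I \sum_(J | (I :|: J == A) && [disjoint I & J]) F I J
  = \sum_(I : {set 'I_p} | I \subset A) F I (A :\: I).
Proof.
rewrite [RHS]big_mkcond; apply: eq_bigr => I _.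
case: ifP => sIA; last first.
  by rewrite big_pred0 // => J; apply: contraFF sIA => /andP[/eqP <- _]; exact: subsetUl.
rewrite (big_pred1 (A :\: I)) // => J; apply/andP/eqP => [[/eqP <- dIJ]|->].
  by rewrite setDUl setDv set0U (setDidPl _) // disjoint_sym.
rewrite -{1}(setIidPr sIA) setID; split=> //.
by rewrite -setI_eq0 setDE setICA setICr setI0.
Qed.

Variables (K : fieldType) (n : nat) (d : 'I_p -> 'rV[int]_n).

(** The greatest index x crosses exactly the indices listed behind it. *)
Lemma koszul_max x (s t : seq 'I_p) : (forall i, i \in s ++ t -> (i < x)%N) ->
  koszul K d (s ++ x :: t) = koszul K d (s ++ t) * ksign K (d x) (wdeg d t).
Proof.
elim: s => [|i s IH] ltx /=.
  rewrite ksign_sumr mulrC -big_filter; congr (_ * \prod_(j <- _) _).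
  by apply/all_filterP/allP.
rewrite IH => [|j jst]; last by apply: ltx; rewrite inE jst orbT.
rewrite mulrA !big_cat big_cons /= ltnNge ltnW //.
by apply: ltx; rewrite mem_head.
Qed.

(** By induction on the maximum x of A: if x joins I, it is followed by J and
    crosses it (koszul_max); if x joins J, it is the last of all indices and
    contributes no sign.  These are the two summands of unsh_cons. *)
Lemma unsh_sets (W : lmodType K) A (G : seq 'I_p -> seq 'I_p -> W) :
  unsh d (rev (enum A)) G
  = \sum_(I : {set 'I_p}) \sum_(J | (I :|: J == A) && [disjoint I & J])
      koszul2 K d I J *: G (rev (enum I)) (rev (enum J)).
Proof.
rewrite big_disjoint_cover; elim/set_max_ind: A G => [|x A ltx IH] G.
  rewrite enum_set0 (big_pred1 set0) => [|I]; last by rewrite subset0.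
  by rewrite setD0 enum_set0 /koszul2 enum_set0 scale1r.
have xA : x \notin A by apply/negP => /ltx; rewrite ltnn.
have sub I i : I \subset A -> i \in I -> (i < x)%N.
  by move=> /subsetP sIA /sIA/ltx.
rewrite big_subsets_setU1 // enum_setU1_max // rev_rcons unsh_cons !IH.
congr (_ + _); apply: eq_bigr => I sIA.
  rewrite -setDDl setU1K // /koszul2 enum_setU1_max; last by move=> i; exact: sub.
  rewrite cat_rcons rev_rcons koszul_max => [|i]; last first.
    by rewrite mem_cat !mem_enum => /orP[/sub->//|]; apply: sub; exact: subsetDl.
  by rewrite scalerA ksignC /wdeg big_rev.
have xI : x \notin I by apply: contra xA; apply: subsetP.
have -> : (x |: A) :\: I = x |: (A :\: I).
  by rewrite setDUl; congr (_ :|: _); apply/setDidPl; rewrite disjoints1.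
rewrite /koszul2 (enum_setU1_max (A := A :\: I)) => [|i]; last first.
  by apply: sub; exact: subsetDl.
rewrite -cats1 catA koszul_max => [|i]; last first.
  by rewrite cats0 mem_cat !mem_enum => /orP[/sub->//|]; apply: sub; exact: subsetDl.
by rewrite cats0 wdeg_nil ksign0r mulr1 cats1 rev_rcons.
Qed.
End IndexSets.

(** In a triple (I, J, L) with I and J before the minimum k of L, the set L
    must be the final segment from k on, so that the triple is an unshuffle of
    the indices below k. *)
Lemma cut_at p (k : 'I_p) (I J L : {set 'I_p}) :
  [&& I :|: J :|: L == [set: 'I_p], [disjoint I & J], [disjoint I & L]
    & [disjoint J & L]]
  && [&& k \in L, [forall l in L, (k <= l)%N],
         [forall i in I, (i < k)%N] & [forall j in J, (j < k)%N]]
  = ((I :|: J == [set i : 'I_p | (i < k)%N]) && [disjoint I & J])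
    && (L == [set i : 'I_p | (k <= i)%N]).
Proof.
apply/idP/idP.
  case/andP=> /and4P[/eqP IJL dIJ dIL dJL] /and4P[kL Lge Ilt Jlt].
  have Llt i : (i \in L) = (k <= i)%N.
    apply/idP/idP => [iL|ki]; first exact: (forall_inP Lge).
    have := in_setT i; rewrite -IJL !inE -orbA.
    by move=> /or3P[/(forall_inP Ilt)|/(forall_inP Jlt)|//]; rewrite ltnNge ki.
  rewrite dIJ andbT; apply/andP; split; apply/eqP/setP => i; rewrite !inE ?Llt //.
  apply/orP/idP => [[/(forall_inP Ilt)|/(forall_inP Jlt)]//|ik].
  have := in_setT i; rewrite -IJL !inE Llt leqNgt ik orbF.
  exact/orP.
case/andP=> /andP[/eqP IJ dIJ] /eqP->.
have ltk i : (i \in I) || (i \in J) = (i < k)%N by rewrite -in_setU IJ inE.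
apply/andP; split; apply/and4P; split => //.
- by apply/eqP/setP => i; rewrite IJ !inE ltnNge orNb.
- rewrite disjoint_subset; apply/subsetP => i iI.
  by rewrite !inE -ltnNge -ltk iI.
- rewrite disjoint_subset; apply/subsetP => i iJ.
  by rewrite !inE -ltnNge -ltk iJ orbT.
- by rewrite inE.
- by apply/forall_inP => l; rewrite inE.
- by apply/forall_inP => i iI; rewrite -ltk iI.
- by apply/forall_inP => j jJ; rewrite -ltk jJ orbT.
Qed.

Section Letters.
Variables (K : fieldType) (n : nat) (X Y : eqType) (deg : X -> 'rV[int]_n) (f : Y -> X).

Lemma wdeg_map w : wdeg deg (map f w) = wdeg (deg \o f) w.
Proof. exact: big_map. Qed.

Lemma unsh_letters (W : lmodType K) w (G : seq X -> seq X -> W) :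
  unsh deg (map f w) G = unsh (deg \o f) w (fun a b => G (map f a) (map f b)).
Proof.
elim: w G => [//|y w IH] G; rewrite map_cons !unsh_cons !IH; congr (_ + _).
by apply: eq_unsh => a b _; rewrite wdeg_map.
Qed.
End Letters.

(** The recursion for insert unrolled: one term for each position k of the
    letter k_1, with the letters behind k as tail. *)
Lemma insert_sets (K : fieldType) n (X : eqType) (deg : X -> 'rV[int]_n) Q
  (M : seq X -> X) p (f : 'I_p -> X) (W : lmodType K) (A : {set 'I_p}) (G : seq X -> W) :
  insert deg Q M (map f (rev (enum A))) G
  = \sum_(k in A) unsh (deg \o f) (rev (enum [set i in A | (i < k)%N]))
      (fun a b => ksign K Q (wdeg (deg \o f) a) *:
         G (map f (rev (enum [set i in A | (k < i)%N])) ++ M (f k :: map f b) :: map f a)).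
Proof.
elim/set_max_ind: A G => [|x A ltx IH] G; first by rewrite enum_set0 big_set0.
have xA : x \notin A by apply/negP => /ltx; rewrite ltnn.
rewrite enum_setU1_max // rev_rcons map_cons insert_cons IH big_setU1 // [RHS]addrC.
congr (_ + _); last first.
  have -> : [set i in x |: A | (i < x)%N] = A.
    apply/setP => i; rewrite !inE; case: eqP => [->|_] /=.
      by rewrite ltnn (negPf xA).
    by apply: andb_idr => /ltx.
  have -> : [set i in x |: A | (x < i)%N] = set0.
    apply/setP => i; rewrite !inE; apply/negP => /andP[/predU1P[->|/ltx ix]].
      by rewrite ltnn.
    by rewrite ltnNge ltnW.
  rewrite unsh_letters enum_set0; apply: eq_unsh => a b _; by rewrite wdeg_map.
apply: eq_bigr => k kA.
have -> : [set i in x |: A | (i < k)%N] = [set i in A | (i < k)%N].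
  apply/setP => i; rewrite !inE; case: eqP => [->|//] /=.
  by rewrite (negPf xA) ltnNge ltnW // ltx.
have -> : [set i in x |: A | (k < i)%N] = x |: [set i in A | (k < i)%N].
  apply/setP => i; rewrite !inE; case: eqP => [->|//] /=.
  by rewrite ltx.
rewrite enum_setU1_max ?rev_rcons // => i; by rewrite inE => /andP[/ltx].
Qed.

(** * Words of homogeneous vectors *)

Section TensorLinear.
Variables (K : fieldType) (U W : lmodType K).

Definition tprodl (w : W) (u : U) : tensor U W := u ⊗ w.
Definition tprodr (u : U) (w : W) : tensor U W := u ⊗ w.

Fact tprodl_linear w : linear (tprodl w).
Proof. by move=> c u u'; exact: tprodPl. Qed.
Fact tprodr_linear u : linear (tprodr u).
Proof. by move=> c w w'; exact: tprodPr. Qed.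
HB.instance Definition _ w :=
  GRing.isLinear.Build K U (tensor U W) _ (tprodl w) (tprodl_linear w).
HB.instance Definition _ u :=
  GRing.isLinear.Build K W (tensor U W) _ (tprodr u) (tprodr_linear u).
End TensorLinear.

Section GradedWords.
Variables (K : fieldType) (n : nat) (V : gradedSpace K n).
Local Notation Z := 'rV[int]_n.
Local Notation T := (tspace V).
Local Notation letter := (Z * V)%type.
Local Notation deg := (@fst Z V).
Implicit Types (w a b r s t : seq letter) (y z : letter).

(** Undoes the right-to-left storage of words. *)
Definition rtens w : T := tens (unzip2 (rev w)).

Lemma homog_rtens w : homog_word w -> tens_homog (wdeg deg w) (rtens w).
Proof.
move=> hw; apply: span_gen; exists (rev w); first by move=> z; rewrite mem_rev; exact: hw.
by rewrite /wdeg big_rev.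
Qed.

Lemma homog_word_perm w a b : perm_eq (a ++ b) w -> homog_word w ->
  homog_word a /\ homog_word b.
Proof.
move=> ab hw; split=> z za; apply: hw; rewrite -(perm_mem ab) mem_cat za //.
by rewrite orbT.
Qed.

Lemma rtens_span (x : T) :
  Defs.span (fun u => exists2 w, homog_word w & u = rtens w) x.
Proof.
elim: (tens_homog_span x) => {x} [_ [w hw ->]||c x y _ ? _ ?].
- apply: span_gen; exists (rev w); last by rewrite /rtens revK.
  by move=> z; rewrite mem_rev; exact: hw.
- exact: span_zero.
- exact: span_lin.
Qed.

Lemma rtens_family p (e : 'I_p -> letter) (I : {set 'I_p}) :
  rtens (map e (rev (enum I))) = tens (subword (snd \o e : 'I_p -> V) I).
Proof. by rewrite /rtens -map_rev revK /unzip2 -map_comp. Qed.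

(** Turns a word into a family over ordinals, the form in which the coproduct is
    specified. *)
Lemma word_family w : exists e : 'I_(size w) -> letter,
  w = map e (rev (enum [set: 'I_(size w)])).
Proof.
exists (fun i => nth (0, 0) (rev w) i); rewrite map_rev; apply: (canRL revK).
rewrite enum_setT -enumT map_comp val_enum_ord -[in RHS](size_rev w).
by rewrite -/(mkseq _ _) mkseq_nth.
Qed.

Lemma enum_setT_max p : enum [set: 'I_p.+1] = rcons (enum [set~ ord_max]) ord_max.
Proof.
have -> : [set: 'I_p.+1] = ord_max |: [set~ ord_max].
  by apply/setP => i; rewrite !inE orbN.
rewrite enum_setU1_max // => i.
by rewrite !inE -val_eqE /= => /negPf i_max; rewrite ltn_neqAle i_max leq_ord.
Qed.

(** The terms of half_unsh with an empty left word, which have no counterpart on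
    the left, contribute nothing: the tensor of the empty word is zero. *)
Lemma coprod_formulaE p (e : 'I_p.+1 -> letter) :
  coprod_formula (deg \o e) (snd \o e : _ -> V)
  = half_unsh deg (map e (rev (enum [set: 'I_p.+1]))) (fun a b => rtens a ⊗ rtens b).
Proof.
rewrite enum_setT_max rev_rcons /= unsh_letters unsh_sets.
apply: eq_bigr => I _; rewrite [RHS](bigID (fun=> I != set0)) /= [X in _ + X]big1 ?addr0.
  apply: eq_big => [J|J _]; first by rewrite andbA.
  rewrite rtens_family -map_cons /rtens -map_rev rev_cons revK.
  by rewrite /unzip2 -map_comp map_rcons.
move=> J /andP[_]; rewrite negbK => /eqP->.
by rewrite enum_set0 /rtens /= tens0 -[_ ⊗ _]/(tprodl _ _) linear0 scaler0.
Qed.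

Lemma coprod_rtens w : homog_word w ->
  coprod V (rtens w) = half_unsh deg w (fun a b => rtens a ⊗ rtens b).
Proof.
case: w => [|y w] hw; first by rewrite /rtens tens0 linear0.
have [e we] := word_family (y :: w); rewrite we in hw *.
rewrite -coprod_formulaE -coprodE => [|i].
  by rewrite rtens_family; congr (coprod V (tens _)); rewrite /= enum_setT -enumT.
by apply: (hw (e i)); rewrite map_f // mem_rev mem_enum inE.
Qed.
End GradedWords.

Section Corestrictions.
Variables (K : fieldType) (n : nat) (V : gradedSpace K n) (Q : 'rV[int]_n).
Variable m : multis V Q.
Local Notation Z := 'rV[int]_n.
Local Notation T := (tspace V).
Local Notation letter := (Z * V)%type.
Local Notation deg := (@fst Z V).
Implicit Types (w a b r s t : seq letter) (y z : letter).

(** All the maps Q_p at once, as one function on words; total, with value 0 on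
    the empty word. *)
Definition multi_seq (s : seq V) : V :=
  if s is x :: s' then m (size s') (in_tuple (x :: s')) else 0.

Lemma multi_seqE k (s : k.+1.-tuple V) : multi_seq s = m k s.
Proof.
case: s => [[|x s] //= /[dup] /eqP[<-] sz].
by congr (multi_fun _ _); apply: val_inj.
Qed.

(** The degree is carried along, so that later signs can be read off it even
    when the vector happens to be zero. *)
Definition merged_letter b : letter := (wdeg deg b + Q, multi_seq (unzip2 (rev b))).

Lemma homog_merged_letter y b : homog_word (y :: b) ->
  homog (merged_letter (y :: b)).1 (merged_letter (y :: b)).2.
Proof.
move=> hb /=; have sz : size (rev (y :: b)) == (size b).+1 by rewrite size_rev.
pose z := Tuple sz.
have /asboolP[_ mw] : multi_fun (m (size b)) \in @multi_pred _ _ V Q _ := valP _.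
have -> : wdeg deg (y :: b) = \sum_i (tnth z i).1.
  by rewrite -(big_tuple _ _ z xpredT deg) big_rev.
have -> : multi_seq (unzip2 (rev (y :: b))) = m (size b) (map_tuple snd z).
  by rewrite -multi_seqE.
apply: mw => i; rewrite tnth_map; apply: hb; rewrite -mem_rev.
exact: (mem_tnth i z).
Qed.

Lemma coder_formulaE p (e : 'I_p -> letter) :
  coder_formula m (deg \o e) (snd \o e : _ -> V)
  = insert deg Q merged_letter (map e (rev (enum [set: 'I_p]))) (@rtens K n V).
Proof.
rewrite insert_sets (eq_bigl xpredT) => [|k]; last by rewrite inE.
have setTE (P : pred 'I_p) : [set i in [set: 'I_p] | P i] = [set i | P i].
  by apply/setP => i; rewrite !inE.
under [RHS]eq_bigr => k _ do rewrite !setTE unsh_sets.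
rewrite [RHS]exchange_big; apply: eq_bigr => I _ /=.
rewrite [RHS](exchange_big_dep xpredT) //=; apply: eq_bigr => J _.
rewrite (exchange_big_dep xpredT) //= [RHS]big_mkcond; apply: eq_bigr => k _.
rewrite (eq_bigl _ _ (cut_at k I J)).
case: ifP => IJk; last by rewrite big_pred0.
rewrite (big_pred1 [set i : 'I_p | (k <= i)%N]) //= scalerA; congr (_ * _ *: _).
  by rewrite /wdeg big_rev big_enum.
congr tens; rewrite /rtens rev_cat rev_cons /unzip2 map_cat map_rcons cat_rcons.
rewrite -!map_rev !revK -!map_comp; congr (_ ++ _ :: _).
  rewrite -multi_seqE /= rev_cons /unzip2 map_rcons -!map_rev revK -map_comp.
  by congr multi_seq.
have -> // : [set i : 'I_p | (k < i)%N] = [set i : 'I_p | (k <= i)%N] :\ k.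
by apply/setP => i; rewrite !inE ltn_neqAle -val_eqE eq_sym.
Qed.
End Corestrictions.

(** * Multilinearity of the unshuffle sums *)

(** Subspaces that contain all the terms contain the sums; S is a predicate
    because graded pieces are given as such. *)
Section Closed.
Variables (K : fieldType) (n : nat) (X : eqType) (deg : X -> 'rV[int]_n).
Variables (W : lmodType K) (S : W -> Prop).
Hypotheses (S0 : S 0) (SP : forall c x y, S x -> S y -> S (c *: x + y)).

Let SZ c x : S x -> S (c *: x).
Proof. by move=> Sx; rewrite -[c *: x]addr0; exact: SP. Qed.
Let SD x y : S x -> S y -> S (x + y).
Proof. by move=> Sx; rewrite -[x]scale1r; exact: SP. Qed.

Lemma unsh_closed w (G : seq X -> seq X -> W) :
  (forall a b, perm_eq (a ++ b) w -> S (G a b)) -> S (unsh deg w G).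
Proof.
elim: w G => [|y w IH] G SG; first exact: SG.
rewrite unsh_cons; apply: SD; apply: IH => a b ab; first apply: SZ; apply: SG.
  by rewrite /= perm_cons.
by rewrite -[y :: b]cat1s perm_catCA perm_cons.
Qed.

Lemma insert_closed Q (M : seq X -> X) w (G : seq X -> W) :
  (forall t y a b, perm_eq (t ++ y :: a ++ b) w -> S (G (t ++ M (y :: b) :: a))) ->
  S (insert deg Q M w G).
Proof.
elim: w G => [//|y w IH] G SG; rewrite insert_cons; apply: SD.
  by apply: IH => t x a b p; rewrite -cat_cons; apply: SG; rewrite /= perm_cons.
apply: unsh_closed => a b ab; apply/SZ/(SG [::] y a b).
by rewrite /= perm_cons.
Qed.
End Closed.

Section DegMultilinear.
Variables (K : fieldType) (n : nat) (V : gradedSpace K n) (W : lmodType K).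
Local Notation letter := ('rV[int]_n * V)%type.
Local Notation deg := (@fst 'rV[int]_n V).

Lemma wdeg_letter s t (d : 'rV[int]_n) (u v : V) :
  wdeg deg (s ++ (d, u) :: t) = wdeg deg (s ++ (d, v) :: t).
Proof. by rewrite /wdeg !big_cat !big_cons. Qed.

Lemma deg_multilinear_rev (F : seq letter -> W) :
  deg_multilinear F -> deg_multilinear (F \o rev).
Proof. by move=> Fl s t d c u v; rewrite /= !rev_cat !rev_cons !cat_rcons. Qed.

Lemma deg_multilinear_unzip2 (F : seq V -> W) :
  seq_multilinear F -> deg_multilinear (F \o unzip2).
Proof. by move=> Fl s t d c u v; rewrite /= /unzip2 !map_cat /=. Qed.

Lemma deg_multilinear_cons (F : seq letter -> W) z :
  deg_multilinear F -> deg_multilinear (fun r => F (z :: r)).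
Proof. by move=> Fl s t d c u v; exact: (Fl (z :: s)). Qed.

Lemma deg_multilinear_scale (F : seq letter -> W) (e : 'rV[int]_n -> K) :
  deg_multilinear F -> deg_multilinear (fun r => e (wdeg deg r) *: F r).
Proof.
move=> Fl s t d c u v; rewrite Fl -!(wdeg_letter s t d (c *: u + v)).
by rewrite scalerDr !scalerA mulrC.
Qed.

Lemma unsh_multilinear (G : seq letter -> seq letter -> W) :
  (forall b, deg_multilinear (G^~ b)) -> (forall a, deg_multilinear (G a)) ->
  deg_multilinear (fun w => unsh deg w G).
Proof.
move=> Gl Gr s t d c u v; elim: s G Gl Gr => [|z s IH] G Gl Gr.
  rewrite !cat0s !unsh_cons scalerDr addrACA -!unsh_linear.
  congr (_ + _); apply: eq_unsh => a b _; last exact: (Gr a [::]).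
  by rewrite (Gl b [::]) scalerDr !scalerA mulrC.
rewrite !cat_cons !unsh_cons scalerDr addrACA; congr (_ + _); apply: IH.
- move=> b s' t' d' c' u' v'; rewrite (Gl b (z :: s')).
  by rewrite scalerDr !scalerA mulrC.
- by move=> a; apply: (deg_multilinear_scale (fun x => ksign K x z.1)).
- by move=> b; apply: Gl.
- by move=> a; apply: deg_multilinear_cons.
Qed.

(** The letter that varies may be in the tail, merged, or in front of the merged
    letter.  The degree of the merged letter only depends on the degrees of the
    letters it is made of, so the signs do not vary. *)
Lemma insert_multilinear Q (M : seq letter -> letter) (G : seq letter -> W) :
  (forall b, (M b).1 = wdeg deg b + Q) -> deg_multilinear (fun b => (M b).2) ->
  deg_multilinear G -> deg_multilinear (fun w => insert deg Q M w G).
Proof.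
move=> M1 M2; have GM (G' : seq letter -> W) a :
    deg_multilinear G' -> deg_multilinear (fun b => G' (M b :: a)).
  move=> G'l s t d c u v.
  rewrite [M _]surjective_pairing [M (s ++ (d, u) :: t)]surjective_pairing.
  rewrite [M (s ++ (d, v) :: t)]surjective_pairing !M1 M2.
  rewrite !(wdeg_letter s t d (c *: u + v) 0) (wdeg_letter s t d u 0).
  by rewrite (wdeg_letter s t d v 0) (G'l [::]).
move=> Gl s t d c u v; elim: s G Gl => [|z s IH] G Gl.
  rewrite !cat0s !insert_cons scalerDr addrACA -insert_linear -unsh_linear.
  congr (_ + _); first by apply: eq_insert => *; exact: (Gl [::]).
  apply: eq_unsh => a b _; rewrite (GM G a Gl [::]).
  by rewrite scalerDr !scalerA mulrC.
rewrite !cat_cons !insert_cons scalerDr addrACA; congr (_ + _).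
  by apply: IH; exact: deg_multilinear_cons.
apply: unsh_multilinear => [b|a].
  apply: (deg_multilinear_scale (F := fun a => G (M (z :: b) :: a)) (ksign K Q)).
  exact: deg_multilinear_cons.
move=> s' t' d' c' u' v'; have := GM G a Gl (z :: s'); rewrite /= => ->.
by rewrite scalerDr !scalerA mulrC.
Qed.
End DegMultilinear.

(** * The coderivation with given corestrictions *)

Section Extension.
Variables (K : fieldType) (n : nat) (V : gradedSpace K n) (Q : 'rV[int]_n).
Local Notation Z := 'rV[int]_n.
Local Notation T := (tspace V).
Local Notation letter := (Z * V)%type.
Local Notation deg := (@fst Z V).
Implicit Types (w a b r s t : seq letter) (y z : letter) (m : multis V Q).

Lemma multi_seq_multilinear m : seq_multilinear (multi_seq m).
Proof.
move=> s t c u v.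
have sz : size (s ++ 0 :: t) == (size s + size t).+1 by rewrite size_cat /= addnS.
pose z := Tuple sz; have lt : (size s < (size s + size t).+1)%N by rewrite ltnS leq_addr.
have E x : multi_seq m (s ++ x :: t) = m _ (tuple_upd z (Ordinal lt) x).
  rewrite -multi_seqE tuple_updE /= take_size_cat // drop_cat ltnNge leqnSn /=.
  by rewrite subSn // subnn /= drop0.
have /asboolP[ml _] : multi_fun (m (size s + size t)%N) \in @multi_pred _ _ V Q _ := valP _.
by rewrite !E ml.
Qed.

Lemma rtens_multilinear : deg_multilinear (@rtens K n V).
Proof.
exact: (deg_multilinear_rev (deg_multilinear_unzip2 (@tens_multilinear K V))).
Qed.

Lemma rtens_eq_linear (W : lmodType K) (f g : {linear T -> W}) :
  (forall w, homog_word w -> f (rtens w) = g (rtens w)) -> f =1 g.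
Proof.
by move=> fg x; apply: span_linear (rtens_span x) => _ [w hw ->]; exact: fg.
Qed.

Fact coder_map_exists m : {f : {linear T -> T} | forall w, homog_word w ->
  f (rtens w) = insert deg Q (merged_letter m) w (@rtens K n V)}.
Proof.
apply: cid; pose F := (fun w => insert deg Q (merged_letter m) w (@rtens K n V)) \o rev.
have [||f fE] := @tens_homog_lift K n V T F.
- by [].
- apply/deg_multilinear_rev/insert_multilinear => //; last exact: rtens_multilinear.
  exact: (deg_multilinear_rev (deg_multilinear_unzip2 (multi_seq_multilinear m))).
exists f => w hw; rewrite /rtens fE /F /= ?revK // => z; rewrite mem_rev; exact: hw.
Qed.
Definition coder_map m := sval (coder_map_exists m).

Lemma coder_mapE m w : homog_word w ->
  coder_map m (rtens w) = insert deg Q (merged_letter m) w (@rtens K n V).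
Proof. exact: (svalP (coder_map_exists m)). Qed.

Lemma homog_merge m w t y a b : homog_word w -> perm_eq (t ++ y :: a ++ b) w ->
  homog_word (t ++ merged_letter m (y :: b) :: a)
  /\ wdeg deg (t ++ merged_letter m (y :: b) :: a) = wdeg deg w + Q.
Proof.
move=> hw p; split.
  move=> z; rewrite mem_cat inE => /or3P[zt|/eqP->|za].
  - by apply: hw; rewrite -(perm_mem p) mem_cat zt.
  - apply: homog_merged_letter => x; rewrite inE => xyb; apply: hw.
    by rewrite -(perm_mem p) mem_cat inE mem_cat; case/orP: xyb => ->; rewrite !orbT.
  - by apply: hw; rewrite -(perm_mem p) mem_cat inE mem_cat za !orbT.
rewrite /wdeg -(perm_big _ p) !big_cat !big_cons big_cat /= /wdeg big_cons.
rewrite -!addrA; do 2!congr (_ + _).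
by rewrite addrA addrC.
Qed.

Lemma coder_map_weight m : has_weight (U := tgraded V) (W := tgraded V) Q (coder_map m).
Proof.
move=> d x; elim=> {x} [_ [w hw [<- ->]]||c x y _ hx _ hy]; last first.
- by rewrite linearP; exact: span_lin.
- by rewrite linear0; exact: span_zero.
have hr : homog_word (rev w) by move=> z; rewrite mem_rev; exact: hw.
have -> : tens (unzip2 w) = rtens (rev w) by rewrite /rtens revK.
have -> : \sum_(z <- w) z.1 = wdeg deg (rev w) by rewrite /wdeg big_rev.
rewrite coder_mapE //; apply: insert_closed => [|c x y hx hy|t y a b p].
- exact: span_zero.
- exact: span_lin.
by have [h <-] := homog_merge m hr p; exact: homog_rtens.
Qed.

Lemma gtens_id0 (f : {linear T -> T}) a (u : T) : homog_word a ->
  gtens (U := tgraded V) 0 f (idfun : {linear T -> T}) (rtens a ⊗ u) = f (rtens a) ⊗ u.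
Proof. by move=> /homog_rtens ha; rewrite (gtensE _ _ _ _ ha) ksign0l scale1r. Qed.

Lemma gtens_idr (f : {linear T -> T}) a (u : T) : homog_word a ->
  gtens (U := tgraded V) Q (idfun : {linear T -> T}) f (rtens a ⊗ u)
  = ksign K Q (wdeg deg a) *: (rtens a ⊗ f u).
Proof. by move=> /homog_rtens ha; rewrite (gtensE _ _ _ _ ha). Qed.

(** The only sign comes from moving f past the left factor. *)
Lemma coder_rhs (f : {linear T -> T}) w : homog_word w ->
  gtens (U := tgraded V) 0 f (idfun : {linear T -> T}) (coprod V (rtens w))
  + gtens (U := tgraded V) Q (idfun : {linear T -> T}) f (coprod V (rtens w))
  = half_unsh deg w (fun a b => f (rtens a) ⊗ rtens b)
    + half_unsh deg w (fun a b => ksign K Q (wdeg deg a) *: (rtens a ⊗ f (rtens b))).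
Proof.
move=> hw; rewrite (coprod_rtens hw) (half_unsh_hom _ (gtens 0 _ _)).
rewrite (half_unsh_hom _ (gtens Q _ _)).
by congr (_ + _); apply: eq_half_unsh => a y b /homog_word_perm/(_ hw)[ha _];
  rewrite (gtens_id0, gtens_idr).
Qed.

(** Both sides are linear in the argument, so it is enough to compare them on
    words, where the identity is insert_half_unsh. *)
Lemma coder_map_coder m : coder_map m \in coder_pred Q.
Proof.
apply/asboolP; split; first exact: coder_map_weight.
pose L : {linear T -> tensor T T} := coprod V \o coder_map m.
pose R : {linear T -> tensor T T} :=
  (gtens (U := tgraded V) 0 (coder_map m) (idfun : {linear T -> T}) \o coprod V)
  \+ (gtens (U := tgraded V) Q (idfun : {linear T -> T}) (coder_map m) \o coprod V).
apply: (rtens_eq_linear (f := L) (g := R)) => w hw.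
rewrite [RHS]coder_rhs // /L /= coder_mapE // insert_hom.
transitivity (insert deg Q (merged_letter m) w
    (fun r => half_unsh deg r (fun a b => rtens a ⊗ rtens b))).
  apply: eq_insert => t y a b p; apply: coprod_rtens.
  by have [] := homog_merge m hw p.
rewrite insert_half_unsh //; congr (_ + _); apply: eq_half_unsh => a y b ab;
  have [ha hb] := homog_word_perm ab hw; rewrite coder_mapE //.
  exact: (esym (insert_hom _ _ _ (tprodl (rtens (y :: b))) _ _)).
congr (_ *: _); exact: (esym (insert_hom _ _ _ (tprodr (rtens a)) _ _)).
Qed.

Definition coder_of m : coder V Q := Coder (coder_map_coder m).

Lemma pr_rtens w : tens_pr V (rtens w) = if w is [:: z] then z.2 else 0.
Proof.
case: w => [|y [|z w]]; rewrite tens_prE //.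
rewrite !rev_cons -!cats1 -catA /unzip2 map_cat.
by case: (map _ (rev w)) => [|? [|? ?]].
Qed.

(** The projection to V sees only the term in which the whole word is merged:
    I empty and k_1 last. *)
Lemma pr_coder_map m w : homog_word w ->
  tens_pr V (coder_map m (rtens w)) = multi_seq m (unzip2 (rev w)).
Proof.
case: w => [|y w] hw; first by rewrite /rtens tens0 !linear0.
rewrite coder_mapE // insert_hom insert_cons unsh_nill => [|a z b]; last first.
  by rewrite pr_rtens scaler0.
rewrite wdeg_nil ksign0r scale1r pr_rtens -[RHS]add0r; congr (_ + _).
transitivity (insert deg Q (merged_letter m) w (fun=> 0 *: (0 : V))).
  by apply: eq_insert => t x a b _; rewrite pr_rtens scale0r; case: t.
by rewrite insertZ scale0r.
Qed.

(** Two multilinear maps that agree on homogeneous vectors agree, as both extend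
    to linear maps on T(V). *)
Lemma corestr_coder_of : cancel coder_of (@corestr K n V Q).
Proof.
move=> m; apply: functional_extensionality_dep => k; apply: val_inj.
apply/funext => v; have [mu muE] : exists f : {linear T -> V},
    forall s : seq V, f (tens s) = multi_seq m s.
  by apply: tens_lift => //; exact: multi_seq_multilinear.
rewrite /= -multi_seqE -muE; pose L : {linear T -> V} := tens_pr V \o coder_map m.
apply: (rtens_eq_linear (f := L) (g := mu)) => w hw.
by rewrite /L /= pr_coder_map // muE.
Qed.

Lemma corestr_linear : linear (@corestr K n V Q).
Proof.
move=> c D D'; apply: functional_extensionality_dep => k; apply: val_inj.
apply/funext => v; exact: (linearP (tens_pr V) c (D (tens v)) (D' (tens v))).
Qed.

(** * Recovering a coderivation from its corestrictions *)

(** The map u ⊗ x |-> u ⊗ pr x from T ⊗ T to T that appends one vector.  It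
    must kill an empty u, which is zero in T(V), although the empty word
    followed by v is a nonzero word.  The degree 0 in the new letter is a dummy,
    since rtens forgets degrees. *)
Fact append_exists : {kappa : {linear tensor T T -> T} |
  forall w x, kappa (rtens w ⊗ x) = if w is [::] then 0 else rtens ((0, tens_pr V x) :: w)}.
Proof.
apply: cid; pose F v (s : seq V) : T := if s is [::] then 0 else tens (rcons s v).
have Fl v : seq_multilinear (F v).
  move=> s t c u u'; have FE x : F v (s ++ x :: t) = tens (s ++ x :: rcons t v).
    by rewrite -rcons_cons -rcons_cat; case: s.
  by rewrite !FE tens_multilinear.
have /choice[app appE] : forall v, exists f : {linear T -> T},
    forall s : seq V, f (tens s) = F v s.
  by move=> v; apply: tens_lift.
have appl c v v' x : app (c *: v + v') x = c *: app v x + app v' x.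
  elim: (tens_span x) => {x} [_ [s ->]||d x y _ IHx _ IHy].
  - rewrite !appE; rewrite /F; case: s => [|u s]; first by rewrite /= scaler0 addr0.
    by rewrite -!cats1 tens_multilinear.
  - by rewrite (linear0 (app v)) (linear0 (app v')) (linear0 (app _)) scaler0 addr0.
  - by rewrite !(linearP (app _)) IHx IHy !scalerDr !scalerA mulrC -!scalerA addrACA.
have [||f fE] := @tensor_lift K T T T (fun x x' => app (tens_pr V x') x).
- by move=> c u u' w; rewrite linearP.
- by move=> c u w w'; rewrite linearP appl.
exists f => w x; rewrite fE appE; case: w => [|y w]; first by [].
rewrite /rtens !rev_cons /unzip2 !map_rcons /=.
by case: (map _ (rev w)).
Qed.
Definition append := sval append_exists.
Lemma appendE w x :
  append (rtens w ⊗ x) = if w is [::] then 0 else rtens ((0, tens_pr V x) :: w).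
Proof. exact: (svalP append_exists). Qed.

Lemma append0 w x : tens_pr V x = 0 -> append (rtens w ⊗ x) = 0.
Proof.
move=> x0; rewrite appendE x0 -(linear0 (tens_pr V)) -appendE.
by rewrite -[_ ⊗ 0]/(tprodr (rtens w) 0) !linear0.
Qed.

Definition word1 (v : V) : T := tens [:: v].
Fact word1_linear : linear word1.
Proof. by move=> c u v; exact: (tens_multilinear [::] [::]). Qed.
HB.instance Definition _ := GRing.isLinear.Build K V T _ word1 word1_linear.

(** In the coproduct of a word, append only keeps the term whose right factor is
    the last letter alone; its left factor is empty precisely for words of
    length one, which pr accounts for. *)
Lemma coprod_recover (x : T) : x = word1 (tens_pr V x) + append (coprod V x).
Proof.
pose R : {linear T -> T} := (word1 \o tens_pr V) \+ (append \o coprod V).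
apply: (rtens_eq_linear (f := idfun : {linear T -> T}) (g := R)) => {x} w hw.
rewrite /R /= coprod_rtens // half_unsh_hom pr_rtens.
case: w hw => [|y w] hw; first by rewrite /rtens tens0 linear0 addr0.
rewrite /= unsh_nilr => [|a z b]; last first.
  by apply: append0; rewrite pr_rtens.
rewrite appendE pr_rtens; case: w hw => [|z w] _; first by rewrite addr0.
by rewrite linear0 add0r /rtens /unzip2 !rev_cons !map_rcons.
Qed.

(** Strong induction on the length: both factors in the coproduct of w are
    shorter than w, except for the right factor when the left one is empty, and
    then the term is zero. *)
Lemma corestr_inj : injective (@corestr K n V Q).
Proof.
move=> D D' DD'; apply: val_inj; apply: linearmapP; apply: rtens_eq_linear => w.
have /asboolP[_ Dc] : coder_fun D \in coder_pred Q := valP D.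
have /asboolP[_ Dc'] : coder_fun D' \in coder_pred Q := valP D'.
have [k] := ubnP (size w); elim: k w => // k IH w; rewrite ltnS => wk hw.
rewrite [LHS]coprod_recover [RHS]coprod_recover; congr (word1 _ + append _).
  case: w {wk hw} => [|y w]; first by rewrite /rtens tens0 !linear0.
  have sz : size (unzip2 (rev (y :: w))) == (size w).+1 by rewrite size_map size_rev.
  exact: (congr1 (fun m => multi_fun (m (size w)) (Tuple sz)) DD').
rewrite Dc Dc'; apply: etrans (coder_rhs D hw) _.
apply: etrans (esym (coder_rhs D' hw)).
apply: f_equal2; apply: eq_half_unsh => a y b ab;
  have [ha hb] := homog_word_perm ab hw; have := perm_size ab;
  rewrite size_cat /= => abw.
  by rewrite IH // (leq_trans _ wk) // -abw addnS ltnS leq_addr.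
case: a ha ab abw => [|z a] ha ab abw.
  by rewrite /rtens tens0 -!/(tprodl _ 0) !linear0.
by congr (_ *: (_ ⊗ _)); apply: IH => //=; rewrite (leq_trans _ wk) // -abw ltnS leq_addl.
Qed.
End Extension.

Theorem theorem1 (K : fieldType) (K_char0 : [pchar K] =i pred0) (n : nat)
  (V : gradedSpace K n) (Q : 'rV[int]_n) :
  linear (@corestr K n V Q) /\
  exists phi : {linear multis V Q -> coder V Q},
    [/\ cancel (@corestr K n V Q) phi,
        cancel phi (@corestr K n V Q) &
        forall (m : multis V Q) (p : nat) (d : 'I_p -> 'rV[int]_n) (v : 'I_p -> V),
          (forall i, homog (d i) (v i)) ->
          phi m (tens [tuple v i | i < p]) = coder_formula m d v].
Proof.
have lin := @corestr_linear K n V Q; split=> //.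
have qK := @corestr_coder_of K n V Q.
have corK : cancel (@corestr K n V Q) (@coder_of K n V Q).
  by move=> D; apply: corestr_inj; rewrite qK.
have qlin : linear (@coder_of K n V Q).
  by move=> c m m'; apply: corestr_inj; rewrite lin !qK.
pose mx := GRing.isLinear.Build K (multis V Q) (coder V Q) _ _ qlin.
pose phi : {linear multis V Q -> coder V Q} := HB.pack (@coder_of K n V Q) mx.
exists phi; split=> // m p d v hv.
pose e i := (d i, v i).
have he : homog_word (map e (rev (enum [set: 'I_p]))) by move=> _ /mapP[i _ ->]; exact: hv.
rewrite (coder_formulaE m e) -coder_mapE // rtens_family /=.
by congr (coder_map m (tens _)); rewrite /= enum_setT -enumT.
Qed.
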